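(* Let $\alpha\in(0,2)$, let $\xi$ be symmetric and regularly varying with index $\alpha$, let $\mathbf{y}_1=(Y_{11},\dots,Y_{1n})^\top$ be the associated self-normalized vector, and let $\mathbf{A}_n=(a^{(n)}_{ij})_{i,j=1}^n$, $n\ge1$, be random Hermitian matrices independent of $\mathbf{y}_1$ such that $\limsup_{n\to\infty}\max_{1\le i\le n}|a_{ii}^{(n)}|<\infty$ almost surely and $\frac1n\sum_{i=1}^n\delta_{a_{ii}^{(n)}}$ converges weakly almost surely to a deterministic probability measure $\nu$ on $\mathbb{R}$. Let $\mu_{\nu,\alpha}$ be the limiting law, as $n\to\infty$, of $\sum_{i=1}^n a^{(n)}_{ii}Y_{1i}^2$, i.e. the probability measure with Stieltjes transform $$s_{\mu_{\nu,\alpha}}(z)=-\frac{\int_{\mathbb{R}}(z-x)^{\frac{\alpha}{2}-1}\,\nu(dx)}{\int_{\mathbb{R}}(z-x)^{\frac{\alpha}{2}}\,\nu(dx)},\qquad z\in\mathbb{C}\setminus[\inf\operatorname{supp}(\nu),\sup\operatorname{supp}(\nu)].$$ If $\nu$ is non-degenerate, then $\mu_{\nu,\alpha}$ has no atom and is absolutely continuous with density $$f_{\nu,\alpha}(x)=\frac{\sin(\frac{\alpha\pi}{2})}{\pi}\cdot\frac{A_\nu(x)\,b_\nu(x)+B_\nu(x)\,a_\nu(x)}{A_\nu(x)^2+B_\nu(x)^2+2\cos(\frac{\alpha\pi}{2})A_\nu(x)B_\nu(x)},$$ where $$A_\nu(x)=\int_{\mathbb{R}}(x-y)_+^{\frac{\alpha}{2}}\nu(dy),\quad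 B_\nu(x)=\int_{\mathbb{R}}(x-y)_-^{\frac{\alpha}{2}}\nu(dy),$$ $$a_\nu(x)=\int_{\mathbb{R}}(x-y)_+^{\frac{\alpha}{2}-1}\nu(dy),\quad b_\nu(x)=\int_{\mathbb{R}}(x-y)_-^{\frac{\alpha}{2}-1}\nu(dy).$$ The density $f_{\nu,\alpha}$ is finite Lebesgue-almost everywhere on $\mathbb{R}$, strictly positive on $K_\nu=(\inf\operatorname{supp}(\nu),\sup\operatorname{supp}(\nu))$, and zero outside $K_\nu$.
   Context: A real random variable $\xi$ is symmetric if $\xi$ and $-\xi$ have the same law. It is regularly varying with index $\alpha>0$ if $\mathbb{P}(|\xi|>x)=x^{-\alpha}L(x)$ for $x>0$, where $L:(0,\infty)\to(0,\infty)$ is slowly varying at infinity, i.e. $L(tx)/L(x)\to1$ as $x\to\infty$ for every $t>0$. Given i.i.d. copies $X_{11},X_{12},\dots$ of $\xi$, put $Y_{1j}=Y_{1j}^{(n)}=X_{1j}/\sqrt{X_{11}^2+\cdots+X_{1n}^2}$, $1\le j\le n$, and $\mathbf{y}_1=(Y_{11},\dots,Y_{1n})^\top$. The Stieltjes transform of a probability measure $\mu$ on $\mathbb{R}$ is $s_\mu(z)=\int_{\mathbb{R}}\frac{1}{x-z}\mu(dx)$, $z\in\mathbb{C}\setminus\operatorname{supp}(\mu)$; complex powers use the principal branch, with $\arg\in(-\pi,\pi]$. A probability measure is degenerate if it is a Dirac measure. Here $t_+=\max(t,0)$, $t_-=\max(-t,0)$; powers $t_\pm^{\beta}$ are understood to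 be $0$ when $t_\pm=0$ (also for $\beta<0$), integrals of non-negative functions may take the value $+\infty$, and $0\cdot\infty=0$. *)

(* Defs.v *)
From HB Require Import structures.
From mathcomp Require Import all_boot all_order all_algebra.
From mathcomp Require Import complex.
From mathcomp Require Import all_classical all_reals all_analysis.
(* Not re-exported by all_analysis, it makes \bar R a measurableType. *)
From mathcomp Require Import measurable_realfun.

Set Implicit Arguments.
Unset Strict Implicit.
Unset Printing Implicit Defensive.

Import Order.TTheory GRing.Theory Num.Theory.
Import numFieldNormedType.Exports.

Local Open Scope classical_set_scope.
Local Open Scope ring_scope.
Local Open Scope complex_scope.

Section regular_variation.
Context (R : realType).

Definition slowly_varying (L : R -> R) : Prop :=
  (forall x, 0 < x -> 0 < L x) /\
  forall t, 0 < t -> L (t * x) / L x @[x --> +oo] --> (1 : R).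

Context d (T : measurableType d) (P : probability T R).

Definition symmetric_rv (xi : {RV P >-> R}) : Prop :=
  forall B : set R, measurable B ->
    P (xi @^-1` B) = P ((fun w => - xi w) @^-1` B).

Definition regularly_varying (a : R) (xi : {RV P >-> R}) : Prop :=
  exists2 L, slowly_varying L &
    forall x, 0 < x -> P [set w | x < `|xi w|] = (x `^ (- a) * L x)%:E.

End regular_variation.

Section independence.
Context d (T : measurableType d) (R : realType) (P : probability T R).

Definition mutually_independent (X : nat -> {RV P >-> R}) : Prop :=
  forall (J : seq nat) (B : nat -> set R), uniq J ->
    (forall j, measurable (B j)) ->
    P (\bigcap_(j in [set` J]) X j @^-1` B j) =
    (\prod_(j <- J) P (X j @^-1` B j))%E.

Definition iid_copies d0 (T0 : measurableType d0) (P0 : probability T0 R)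
    (xi : {RV P0 >-> R}) (X : nat -> {RV P >-> R}) : Prop :=
  mutually_independent X /\
  forall j (B : set R), measurable B -> P (X j @^-1` B) = P0 (xi @^-1` B).

Definition sigma_generated (I : Type) (F : I -> T -> R) : set (set T) :=
  <<s \bigcup_(i in [set: I]) preimage_set_system setT (F i) measurable >>.

Definition independent_families (I J : Type)
    (F : I -> T -> R) (G : J -> T -> R) : Prop :=
  forall E E', sigma_generated F E -> sigma_generated G E' ->
    P (E `&` E') = (P E * P E')%E.

End independence.

Section self_normalization.
Context (R : realType) (T : Type).

(* The indices 1, ..., n become 0, ..., n - 1; on the event where the norm
   vanishes, x / 0 = 0 gives the zero vector. *)
Definition self_normalized (X : nat -> T -> R) (n : nat) (i : 'I_n) (w : T) : R :=
  X i w / Num.sqrt (\sum_(j < n) X j w ^+ 2).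

End self_normalization.

Section random_matrix.
Context (R : realType) (T : Type).

(* The real coordinates of a complex matrix; the boolean selects the
   imaginary part. *)
Definition mx_coord n (M : T -> 'M[R[i]]_n) (k : 'I_n * 'I_n * bool) (w : T) : R :=
  if k.2 then complex.Im (M w k.1.1 k.1.2) else complex.Re (M w k.1.1 k.1.2).

(* The diagonal of a Hermitian matrix is real, so nothing is lost here. *)
Definition mx_diag n (M : T -> 'M[R[i]]_n) (w : T) (i : 'I_n) : R :=
  complex.Re (M w i i).

End random_matrix.

Section measures_on_the_line.
Context (R : realType).
Local Notation RR := (measurableTypeR R).

Definition empirical_measure n (a : 'I_n -> R) : set RR -> \bar R :=
  fun B => ((n%:R^-1)%:E * \sum_(i < n) \d_(a i : RR) B)%E.

Definition weak_cvg (mu_ : nat -> set RR -> \bar R) (mu : set RR -> \bar R) : Prop :=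
  forall g : R -> R, continuous g -> (exists M, forall x, `|g x| <= M) ->
    (\int[mu_ n]_x (g x)%:E @[n --> \oo] --> \int[mu]_x (g x)%:E)%E.

Definition supp (nu : set RR -> \bar R) : set R :=
  [set x | forall e : R, 0 < e -> (0 < nu (ball x e))%E].

Definition degenerate (nu : set RR -> \bar R) : Prop :=
  exists a : RR, forall B, measurable B -> nu B = \d_a B.

End measures_on_the_line.

Section complex_analysis.
Context (R : realType).
Local Notation RR := (measurableTypeR R).

(* Principal argument, in ]-pi, pi], of a nonzero complex number. *)
Definition carg (z : R[i]) : R :=
  let t := acos (complex.Re z / Normc.normc z) in
  if 0 <= complex.Im z then t else - t.

Definition cpow (z : R[i]) (b : R) : R[i] :=
  (Normc.normc z `^ b)%:C * (cos (b * carg z) +i* sin (b * carg z)).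

Definition cintegral (mu : {measure set RR -> \bar R}) (f : R -> R[i]) : R[i] :=
  Rintegral mu setT (fun x => complex.Re (f x)) +i*
  Rintegral mu setT (fun x => complex.Im (f x)).

Definition stieltjes (mu : {measure set RR -> \bar R}) (z : R[i]) : R[i] :=
  cintegral mu (fun x => (x%:C - z)^-1).

End complex_analysis.

Section density.
Context (R : realType).
Local Notation RR := (measurableTypeR R).

Definition tpos (t : R) : R := Num.max t 0.
Definition tneg (t : R) : R := Num.max (- t) 0.

(* For b != 0, 0 `^ b = 0 also when b is negative. *)
Definition int_pos (nu : set RR -> \bar R) (b x : R) : \bar R :=
  (\int[nu]_y (tpos (x - y) `^ b)%:E)%E.
Definition int_neg (nu : set RR -> \bar R) (b x : R) : \bar R :=
  (\int[nu]_y (tneg (x - y) `^ b)%:E)%E.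

(* Extended-real valued, with the library's 0 * +oo = 0. *)
Definition limit_density (nu : set RR -> \bar R) (alpha x : R) : \bar R :=
  let A := int_pos nu (alpha / 2) x in
  let B := int_neg nu (alpha / 2) x in
  let a := int_pos nu (alpha / 2 - 1) x in
  let b := int_neg nu (alpha / 2 - 1) x in
  ((sin (alpha * pi / 2) / pi)%:E *
   ((A * b + B * a) /
    (A ^+ 2 + B ^+ 2 + (2 * cos (alpha * pi / 2))%:E * A * B)))%E.

End density.

(* Main.v *)
(* With [b = alpha / 2] and [z = x +i* e], the kernels [(z - y)^b] and
   [(z - y)^(b - 1)] converge as [e -> 0+] to boundary values given by the
   positive and negative parts of [x - y], so the imaginary part of the Stieltjes
   transform of [mu] at [x +i* e] tends to [pi] times the asserted density at
   every [x] which is not an atom of [nu] and where the potential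
   [int |x - y|^(b - 1) nu(dy)] is finite, that is, at almost every [x].
   As [z - y] has its argument in [0, pi] and [b < 1], rotating by [- b pi / 2]
   shows that the denominator dominates [int |z - y|^b nu(dy)], which is bounded
   away from 0 because [nu] charges two disjoint balls.  Hence the imaginary part
   is dominated by a constant times the potential, which is locally integrable,
   and its integrals over [p, q] converge.  They are also Poisson integrals of
   [mu], so the limit lies between [pi mu ]p, q[ ] and [pi mu [p, q] ].  Therefore
   [mu] has the asserted density, and the other claims follow. *)

Require Import Defs.
From HB Require Import structures.
From mathcomp Require Import all_boot all_order all_algebra.
From mathcomp Require Import complex.
From mathcomp Require Import all_classical all_reals all_analysis.
From mathcomp Require Import measurable_realfun.
From mathcomp Require Import ring lra.

Set Implicit Arguments.
Unset Strict Implicit.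
Unset Printing Implicit Defensive.

Import Order.TTheory GRing.Theory Num.Theory.
Import numFieldNormedType.Exports.

Local Open Scope classical_set_scope.
Local Open Scope ring_scope.
Local Open Scope complex_scope.

(** * The support of the limiting spectral measure *)

(** A bound on the support of [nu] is read off from a single outcome at which the diagonals are
    bounded and their empirical measures converge. It makes the kernel of exponent b integrable at
    every x. The obstacle is the kernel of exponent b - 1: it is singular at e = 0, and the
    potential may be infinite at some x. Two features make dominated convergence on [p, q] possible
    all the same. A negative power of |z - y| grows as e decreases, so its value at e = 0 is a
    majorant for all e > 0 at once. And the lower bound [c] on the integral of |x - y|^b is uniform
    in x, so a single constant stands in front of the potential. Only the imaginary part of the
    Stieltjes transform is followed, since it is the part that is a Poisson integral of [mu];
    everything is then expressed by real integrals, in the polar coordinates of z - y. *)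

Lemma ae_impl d (T : measurableType d) (R : realType)
    (mu : {measure set T -> \bar R}) (A B : T -> Prop) :
  (forall x, A x -> B x) -> {ae mu, forall x, A x} -> {ae mu, forall x, B x}.
Proof. by move=> AB; apply: negligibleS => x /= + Ax; apply; exact: AB. Qed.

Lemma ae_exists d (T : measurableType d) (R : realType) (P : probability T R)
    (Q : T -> Prop) :
  {ae P, forall x, Q x} -> exists x, Q x.
Proof.
move=> aeQ; apply: contrapT => /forallNP noQ.
have := probability_setT P.
suff -> : P setT = 0%E by move/eqP; rewrite eqe eq_sym oner_eq0.
apply/negligibleP; first exact: measurableT.
by apply: negligibleS aeQ => y _ /=; exact: noQ.
Qed.

Section bounded_support.
Context {R : realType}.
Local Notation RR := (measurableTypeR R).

Lemma limn_esup_lty_bounded (u : R^nat) :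
  (limn_esup (EFin \o u) < +oo)%E ->
  exists M, \forall n \near \oo, u n <= M.
Proof.
rewrite /limn_esup /limf_esup => /ereal_inf_lt[_ [A nA <-]] supoo.
have [m Am] := @filter_ex _ _ _ _ nA.
have supfin : ereal_sup ((EFin \o u) @` A) \is a fin_num.
  rewrite fin_numElt supoo andbT (@lt_le_trans _ _ (u m)%:E) ?ltNyr//.
  by apply: ereal_sup_ubound; exists m.
exists (fine (ereal_sup ((EFin \o u) @` A))).
apply: filterS nA => n An.
by rewrite -lee_fin fineK//; apply: ereal_sup_ubound; exists n.
Qed.

Lemma integral_empirical_measure0 n (a : 'I_n -> R) (g : RR -> R) :
  measurable_fun setT g -> (forall x, 0 <= g x) -> (forall i, g (a i) = 0) ->
  (\int[empirical_measure a]_x (g x)%:E = 0)%E.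
Proof.
move=> mg g0 ga.
have ninv0 : (0 <= n%:R^-1 :> R) by rewrite invr_ge0.
(* [msum] is indexed by [nat], so [a] is extended to all naturals; the default 0 is never reached
   for i < n. *)
pose c (i : nat) : RR := if insub i is Some j then a j else 0.
have gc i : (i < n)%N -> g (c i) = 0 by move=> lt_i_n; rewrite /c insubT ga.
pose m : {measure set RR -> \bar R} :=
  mscale (NngNum ninv0) (msum (fun i => \d_(c i)) n).
have -> : empirical_measure a = m :> (set RR -> \bar R).
  apply/funext => B; rewrite /empirical_measure /m /mscale/= /msum/=.
  congr (_ * _)%E; apply: eq_bigr => i _.
  by rewrite /c (valK i).
rewrite ge0_integral_mscale//=; 
  [|exact/measurable_EFinP|by move=> x _; rewrite lee_fin].
rewrite ge0_integral_measure_sum//=; 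
  [|by move=> x _; rewrite lee_fin|exact/measurable_EFinP].
rewrite big1 ?mule0// => i _.
rewrite integral_dirac//; last exact/measurable_EFinP.
by rewrite diracT mul1e gc.
Qed.

(** If M bounds the points for all large n, a bounded continuous test function that vanishes on
    [-M, M] and is positive elsewhere has empirical integrals eventually 0. Its integral against
    [nu] is then 0, which leaves no mass outside [-M, M]. *)
Lemma weak_cvg_bounded (nu : probability RR R) (a : forall n, 'I_n -> R) :
  weak_cvg (fun n => empirical_measure (a n)) nu ->
  (limn_esup (fun n => (\big[Num.max/0]_(i < n) `|a n i|)%:E) < +oo)%E ->
  exists M, {ae nu, forall y, `|y| <= M}.
Proof.
move=> acvg /limn_esup_lty_bounded[M aM]; exists M.
pose g (x : R) := Num.min 1 (Num.max 0 (`|x| - M)).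
have cg : continuous g.
  move=> x; apply: (@continuous_min R R (cst 1) (cst 0 \max (fun x => `|x| - M))).
    exact: cvg_cst.
  apply: (@continuous_max R R (cst 0) (fun x => `|x| - M)); first exact: cvg_cst.
  by apply: cvgB; [exact: norm_continuous|exact: cvg_cst].
have g0 x : 0 <= g x by rewrite le_min ler01 le_max lexx.
have g1 x : g x <= 1 by rewrite ge_min lexx.
have mg : measurable_fun setT g by exact: continuous_measurable_fun.
have nug0 : (\int[nu]_x (g x)%:E = 0)%E.
  have gbd : exists M0, forall x, `|g x| <= M0 by exists 1 => x; rewrite ger0_norm.
  have := acvg g cg gbd.
  suff h : (\int[empirical_measure (a n)]_x (g x)%:E)%E @[n --> \oo] --> 0%E.
    by move=> /cvg_unique; apply.
  apply: cvg_near_cst; apply: filterS aM => n anM.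
  apply: integral_empirical_measure0 => // i.
  rewrite /g max_l ?min_r ?ler01// subr_le0 (le_trans _ anM)//.
  exact: (le_bigmax _ (fun i => `|a n i|) i).
have : ae_eq nu setT (EFin \o g) (cst 0%E).
  apply/(ae_eq_integral_abs nu measurableT); first exact/measurable_EFinP.
  by rewrite -[RHS]nug0; apply: eq_integral => x _; rewrite gee0_abs// lee_fin.
apply: filterS => y /(_ I)[gy0]; rewrite leNgt; apply/negP => My.
by move: gy0; apply/eqP; rewrite gt_eqF// lt_min ltr01/= lt_max subr_gt0 My orbT.
Qed.

(** Each point off the support has a null ball around it, and this ball contains a rational interval
    around the point; there are only countably many of these. *)
Lemma ae_supp (nu : probability RR R) : {ae nu, forall y, supp nu y}.
Proof.
(* The second factor is a condition independent of the point: [F pq] is the interval if that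
   interval is null, and empty otherwise. *)
pose F (pq : rat * rat) : set RR :=
  [set y | (ratr pq.1 : R) < y < ratr pq.2] `&`
  [set _ | nu `](ratr pq.1 : R), ratr pq.2[%classic = 0%E].
have Fnegl pq : nu.-negligible (F pq).
  have [nu0|nu0] := pselect (nu `](ratr pq.1 : R), ratr pq.2[%classic = 0%E).
    exists `](ratr pq.1 : R), ratr pq.2[%classic; split => //.
    by move=> y [/=]; rewrite in_itv.
  by exists set0; split => // y [_ /=] /nu0.
have : nu.-negligible (\bigcup_k (if unpickle k is Some pq then F pq else set0)).
  apply: negligible_bigcup => k.
  by case: unpickle => //; exact: negligible_set0.
apply: negligibleS => y /= /existsNP[e /not_implyP[e0 /negP]].
rewrite -leNgt => nue.
have [p /[!in_itv]/= /andP[yep py]] := 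
  @rat_in_itvoo R (y - e) y ltac:(by rewrite ltrBlDr ltrDl).
have [q /[!in_itv]/= /andP[yq qye]] := 
  @rat_in_itvoo R y (y + e) ltac:(by rewrite ltrDl).
refine (ex_intro2 _ _ (pickle (p, q)) I _).
rewrite pickleK; split; first by rewrite /= py yq.
rewrite /=; apply/eqP; rewrite eq_le measure_ge0 andbT (le_trans _ nue)//.
apply: le_measure; rewrite ?inE//.
  by apply: measurable_ball.
move=> z/=; rewrite in_itv/= /ball/= => /andP[pz zq].
by rewrite ltr_distlC (lt_trans yep pz) (lt_trans zq qye).
Qed.

End bounded_support.

Section support.
Context {R : realType}.
Local Notation RR := (measurableTypeR R).
Variable nu : probability RR R.

Lemma supp_ball0 (y e : R) : 0 < e ->
  {ae nu, forall z, ~ ball y e z} -> ~ supp nu y.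
Proof.
move=> e0 aeb /(_ e e0); apply/negP; rewrite -leNgt.
suff -> : nu (ball y e) = 0%E by [].
apply/negligibleP; first exact: measurable_ball.
by apply: negligibleS aeb => z /= yz; apply.
Qed.

Lemma supp_bounded M : {ae nu, forall y, `|y| <= M} ->
  forall y, supp nu y -> `|y| <= M.
Proof.
move=> nuM y ysupp; rewrite leNgt; apply/negP => My.
apply: (@supp_ball0 y (`|y| - M)) ysupp; first by rewrite subr_gt0.
apply: ae_impl nuM => z zM; rewrite /ball/= => yz.
have := ler_normB y (y - z); rewrite opprB addrC subrK => h.
suff : `|z| > M by rewrite ltNge zM.
have := ler_normB (y - z) y; rewrite addrAC subrr add0r normrN.
have : `|y| <= `|z| + `|y - z|.
  by rewrite (le_trans _ (ler_normD z (y - z)))// addrC subrK.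
lra.
Qed.

Lemma supp_neq0 : supp nu !=set0.
Proof. exact: ae_exists (ae_supp nu). Qed.

Lemma ae_supp_itv M : {ae nu, forall y, `|y| <= M} ->
  {ae nu, forall y, inf (supp nu) <= y <= sup (supp nu)}.
Proof.
move=> nuM; apply: ae_impl (ae_supp nu) => y ysupp; apply/andP; split.
- apply: ge_inf => //; exists (- M) => z /(supp_bounded nuM).
  by rewrite ler_norml => /andP[].
- apply: ub_le_sup => //; exists M => z /(supp_bounded nuM).
  by rewrite ler_norml => /andP[].
Qed.

(** Since [nu] is carried by its support, a support reduced to one point would make it a Dirac
    measure. *)
Lemma nondegenerate_supp : ~ degenerate nu ->
  exists y z, [/\ y < z, supp nu y & supp nu z].
Proof.
move=> ndeg; have [y ysupp] := supp_neq0.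
suff [z zsupp] : exists2 z, supp nu z & z != y.
  by rewrite neq_lt => /orP[zy|yz]; [exists z, y|exists y, z].
apply: contrapT => noz; apply: ndeg; exists y => B mB.
have aey : {ae nu, forall z, z = y}.
  apply: ae_impl (ae_supp nu) => z zsupp; apply: contrapT => /eqP zy.
  by apply: noz; exists z.
rewrite diracE; have [yB|yB] := boolP (y \in B).
  rewrite -[RHS](probability_setT nu); apply/eqP; rewrite eq_le le_measure ?inE//=.
  rewrite -(setUv B) (le_trans (measureU2 _ _ _))//=; first exact: measurableC.
  suff -> : nu (~` B) = 0%E by rewrite adde0.
  apply/negligibleP; first exact: measurableC.
  apply: negligibleS aey => z /= Bz zy; apply: Bz.
  by rewrite zy; apply/set_mem.
apply/negligibleP => //; apply: negligibleS aey => z /= Bz zy.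
by move/negP: yB; apply; rewrite inE -zy.
Qed.

Lemma le_integral_ball (h : RR -> R) (y e k : R) : 0 <= k ->
  measurable_fun setT h -> (forall z, 0 <= h z) ->
  (forall z, `|y - z| < e -> k <= h z) ->
  (k%:E * nu (ball y e) <= \int[nu]_z (h z)%:E)%E.
Proof.
move=> k0 mh h0 kh.
have mb : measurable (ball y e : set RR) by exact: measurable_ball.
rewrite -integral_cst//; apply: (@le_trans _ _ (\int[nu]_(z in ball y e) (h z)%:E)%E).
  by apply: ge0_le_integral => //=; exact/measurable_EFinP/measurable_funTS.
apply: ge0_subset_integral => //; first exact/measurable_EFinP.
by move=> x _; rewrite lee_fin.
Qed.

(** The centres of the two balls are 4e apart, so x is at distance at least 2e from one of them,
    hence at distance at least e from every point of the ball of radius e around it. Taking the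
    smaller of the two masses makes the bound uniform in x. *)
Lemma integral_dist_powR_gt0 b : 0 < b -> ~ degenerate nu ->
  exists2 c, 0 < c & forall x : R, (c%:E <= \int[nu]_y (`|x - y| `^ b)%:E)%E.
Proof.
move=> b0 /nondegenerate_supp[y [z [yz ysupp zsupp]]].
pose e := (z - y) / 4; have e0 : 0 < e by rewrite divr_gt0// subr_gt0.
have fb (t : R) : nu (ball t e) \is a fin_num.
  by rewrite fin_num_measure//; exact: measurable_ball.
pose c := e `^ b * Num.min (fine (nu (ball y e))) (fine (nu (ball z e))).
have mh (x : R) : measurable_fun setT (fun t : RR => `|x - t| `^ b : R).
  apply: (@measurableT_comp _ _ _ _ _ _ (@powR R ^~ b)); first exact: measurable_powR.
  apply: measurableT_comp; first exact: normr_measurable.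
  by apply: measurable_funB; [exact: measurable_cst|exact: measurable_id].
have eb0 : 0 <= e `^ b by exact: powR_ge0.
exists c; first by rewrite mulr_gt0 ?powR_gt0// lt_min !fine_gt0 ?ysupp ?zsupp//= ltey_eq fb.
move=> x; have [xy|xy] := leP (2 * e) `|x - y|.
- apply: (le_trans _ (@le_integral_ball _ y e _ eb0 (mh x) _ _)); last 2 first.
  + by move=> ?; exact: powR_ge0.
  + move=> t yt; apply: ge0_ler_powR; rewrite ?nnegrE//; [exact: ltW|exact: ltW|].
    have := ler_distD t x y; rewrite (distrC t y).
    move: xy yt; set u := `|x - y|; set v := `|y - t|; set w := `|x - t|; lra.
  by rewrite -(fineK (fb y)) -EFinM lee_fin ler_wpM2l// ge_min lexx.
- apply: (le_trans _ (@le_integral_ball _ z e _ eb0 (mh x) _ _)); last 2 first.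
  + by move=> ?; exact: powR_ge0.
  + move=> t zt; apply: ge0_ler_powR; rewrite ?nnegrE//; [exact: ltW|exact: ltW|].
    have := ler_distD x y z; have := ler_distD t x z.
    have : z - y <= `|y - z| by rewrite distrC ler_norm.
    rewrite (distrC t z) (distrC y x).
    move: xy zt; rewrite /e; set u := `|x - y|; set v := `|z - t|; set w := `|x - t|; lra.
  by rewrite -(fineK (fb z)) -EFinM lee_fin ler_wpM2l// ge_min lexx orbT.
Qed.

End support.

(** * Complex powers in real coordinates *)

Section kernel.
Context {R : realType}.
Implicit Types (e t p : R).

(** Polar coordinates of t + i e. For e >= 0 the principal argument is a plain arc cosine, without
    the sign change of [carg]. *)
Definition modulus e t : R := Num.sqrt (t ^+ 2 + e ^+ 2).
Definition angle e t : R := acos (t / modulus e t).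
Definition re_pow p e t : R := modulus e t `^ p * cos (p * angle e t).
Definition im_pow p e t : R := modulus e t `^ p * sin (p * angle e t).

Lemma cpowE p e t : 0 <= e -> cpow (t +i* e) p = re_pow p e t +i* im_pow p e t.
Proof.
move=> e0; rewrite /cpow /carg /= e0 /re_pow /im_pow /modulus /angle.
by apply/eqP; rewrite eq_complex /=; apply/andP; split; apply/eqP; ring.
Qed.

Lemma ler_norm_modulus e t : `|t| <= modulus e t.
Proof. by rewrite -sqrtr_sqr ler_wsqrtr// lerDl sqr_ge0. Qed.

Lemma modulus_gt0 e t : 0 < e -> 0 < modulus e t.
Proof. by move=> e0; rewrite sqrtr_gt0 ltr_wpDl ?sqr_ge0// exprn_gt0. Qed.

Lemma modulus_le e t : 0 <= e -> modulus e t <= `|t| + e.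
Proof.
move=> e0; rewrite -[leRHS]ger0_norm ?addr_ge0// -sqrtr_sqr ler_wsqrtr//.
by rewrite sqrrD real_normK ?num_real// lerD2r lerDl mulrn_wge0// mulr_ge0.
Qed.

Lemma modulusN e t : modulus e (- t) = modulus e t.
Proof. by rewrite /modulus sqrrN. Qed.

Lemma norm_div_modulus e t : 0 < e -> -1 < t / modulus e t < 1.
Proof.
move=> e0; rewrite -ltr_norml normrM normfV (gtr0_norm (modulus_gt0 t e0)).
rewrite ltr_pdivrMr ?modulus_gt0// mul1r -sqrtr_sqr ltr_sqrt ?ltrDl ?exprn_gt0//.
by rewrite ltr_wpDl ?sqr_ge0// exprn_gt0.
Qed.

Lemma angleN e t : 0 < e -> angle e (- t) = pi - angle e t.
Proof.
move=> e0; rewrite /angle modulusN mulNr acosN//.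
by have /andP[/ltW -> /ltW ->] := norm_div_modulus t e0.
Qed.

Lemma angle_itv e t : 0 < e -> 0 <= angle e t <= pi.
Proof.
move=> e0; have /andP[/ltW h1 /ltW h2] := norm_div_modulus t e0.
by rewrite acos_ge0 ?acos_lepi ?h1 ?h2.
Qed.

Lemma continuous_modulus e : continuous (modulus e).
Proof.
move=> t; apply: (@continuous_comp _ _ _ (fun t => t ^+ 2 + e ^+ 2) Num.sqrt).
  by apply: cvgD; [exact: exprn_continuous|exact: cvg_cst].
exact: sqrt_continuous.
Qed.

Lemma continuous_angle e : 0 < e -> continuous (angle e).
Proof.
move=> e0 t; apply: (@continuous_comp _ _ _ (fun t => t / modulus e t) acos).
  apply: cvgM; first exact: cvg_id.
  apply: cvgV; last exact: continuous_modulus.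
  by rewrite gt_eqF// modulus_gt0.
exact/continuous_acos/norm_div_modulus.
Qed.

Lemma measurable_modulus_powR p e :
  measurable_fun setT (fun t => modulus e t `^ p).
Proof.
apply: (@measurableT_comp _ _ _ _ _ _ (@powR R ^~ p)).
  exact: measurable_powR.
apply: continuous_measurable_fun; exact: continuous_modulus.
Qed.

Lemma measurable_re_pow p e : 0 < e -> measurable_fun setT (re_pow p e).
Proof.
move=> e0; apply: measurable_funM; first exact: measurable_modulus_powR.
apply: continuous_measurable_fun => t.
apply: (@continuous_comp _ _ _ (fun t => p * angle e t) cos); last exact: continuous_cos.
by apply: cvgM; [exact: cvg_cst|exact: continuous_angle].
Qed.

Lemma measurable_im_pow p e : 0 < e -> measurable_fun setT (im_pow p e).
Proof.
move=> e0; apply: measurable_funM; first exact: measurable_modulus_powR.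
apply: continuous_measurable_fun => t.
apply: (@continuous_comp _ _ _ (fun t => p * angle e t) sin); last exact: continuous_sin.
by apply: cvgM; [exact: cvg_cst|exact: continuous_angle].
Qed.

Lemma norm_re_pow p e t : `|re_pow p e t| <= modulus e t `^ p.
Proof. by rewrite normrM ger0_norm ?powR_ge0// ler_piMr ?powR_ge0// cos_max. Qed.

Lemma norm_im_pow p e t : `|im_pow p e t| <= modulus e t `^ p.
Proof. by rewrite normrM ger0_norm ?powR_ge0// ler_piMr ?powR_ge0// sin_max. Qed.

(** Continuity of [acos] at the endpoint 1: as [cos] decreases on [0, pi], acos u < d amounts to cos
    d < u. *)
Lemma cvg_acos1 (u : R^nat) : (forall n, -1 <= u n <= 1) -> u @ \oo --> (1 : R) ->
  acos (u n) @[n --> \oo] --> (0 : R).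
Proof.
move=> u1 ucvg; apply/cvgrPdist_lt => eps eps0.
pose d := Num.min eps pi.
have d0 : 0 < d by rewrite lt_min eps0 pi_gt0.
have dpi : d <= pi by rewrite ge_min lexx orbT.
have cosd : cos d < 1.
  by rewrite -cos0 ltr_cos// in_itv/= ?lexx ?pi_ge0 ?dpi ?ltW.
near=> n; have /andP[un1 un2] := u1 n.
rewrite sub0r normrN ger0_norm ?acos_ge0 ?un1//.
suff : acos (u n) < d by rewrite lt_min => /andP[].
rewrite -ltr_cos ?in_itv/= ?acos_ge0 ?acos_lepi ?un1 ?un2 ?dpi ?ltW//.
rewrite acosK ?in_itv/= ?un1//.
by near: n; exact: cvgr_gt ucvg _ cosd.
Unshelve. all: by end_near. Qed.

Section limit.
Variable e : R^nat.
Hypotheses (e_gt0 : forall n, 0 < e n) (e_cvg : e @ \oo --> (0 : R)).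

Lemma cvg_modulus t : modulus (e n) t @[n --> \oo] --> `|t|.
Proof.
rewrite -sqrtr_sqr -[X in Num.sqrt X]addr0.
apply: (@continuous_cvg _ _ _ \oo _ (fun n => t ^+ 2 + e n ^+ 2) (@Num.sqrt R)).
  exact: sqrt_continuous.
apply: cvgD; first exact: cvg_cst.
rewrite -[X in _ --> X](mulr0 0).
by under eq_fun do rewrite expr2; exact: cvgM.
Qed.

Lemma cvg_angle_pos t : 0 < t -> angle (e n) t @[n --> \oo] --> (0 : R).
Proof.
move=> t0; apply: cvg_acos1.
  by move=> n; have /andP[/ltW -> /ltW ->] := norm_div_modulus t (e_gt0 n).
rewrite -[X in _ --> X](divff (lt0r_neq0 t0)).
apply: cvgM; first exact: cvg_cst.
apply: cvgV; first by rewrite gt_eqF.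
by have := cvg_modulus (t := t); rewrite gtr0_norm.
Qed.

Lemma cvg_angle_neg t : t < 0 -> angle (e n) t @[n --> \oo] --> (pi : R).
Proof.
move=> t0; have Nt0 : 0 < - t by rewrite oppr_gt0.
rewrite -[X in _ --> X]subr0.
have -> : (fun n => angle (e n) t) = (fun n => pi - angle (e n) (- t)).
  by apply/funext => n; rewrite angleN// opprB addrC subrK.
by apply: cvgB; [exact: cvg_cst|exact: cvg_angle_pos].
Qed.

Lemma cvg_modulus_powR p t : t != 0 ->
  modulus (e n) t `^ p @[n --> \oo] --> `|t| `^ p.
Proof.
move=> t0; apply: (@continuous_cvg _ _ _ \oo _ (fun n => modulus (e n) t)
  (@powR R ^~ p)); last exact: cvg_modulus.
apply/differentiable_continuous/derivable1_diffP.
by apply: ex_derive; apply: is_derive1_powR; rewrite normr_gt0.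
Qed.


(** The argument tends to 0 for t > 0 and to pi for t < 0. Both cases fit one formula because the
    other part of t is 0 and its power vanishes; this needs p != 0, as the power 0 of 0 is 1. *)
Lemma cvg_re_pow p t : p != 0 -> t != 0 -> re_pow p (e n) t @[n --> \oo] -->
  tpos t `^ p + cos (p * pi) * tneg t `^ p.
Proof.
move=> p0 t0.
have h (l : R) : angle (e n) t @[n --> \oo] --> l ->
    re_pow p (e n) t @[n --> \oo] --> `|t| `^ p * cos (p * l).
  move=> al; apply: cvgM; first exact: cvg_modulus_powR.
  apply: (@continuous_cvg _ _ _ \oo _ (fun n => p * angle (e n) t) (@cos R)).
    exact: continuous_cos.
  by apply: cvgM; [exact: cvg_cst|exact: al].
move: (t0); rewrite neq_lt /tpos /tneg => /orP[tneg|tpos].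
- rewrite (max_r (ltW tneg)) powR0// add0r max_l ?oppr_ge0 ?ltW// mulrC -ltr0_norm//.
  exact/h/cvg_angle_neg.
- rewrite (max_l (ltW tpos)) max_r ?oppr_le0 ?ltW// powR0// mulr0 addr0.
  rewrite -[X in _ --> X]mulr1 -cos0 -(mulr0 p) -[X in X `^ p]gtr0_norm//.
  exact/h/cvg_angle_pos.
Qed.

Lemma cvg_im_pow p t : p != 0 -> t != 0 -> im_pow p (e n) t @[n --> \oo] -->
  sin (p * pi) * tneg t `^ p.
Proof.
move=> p0 t0.
have h (l : R) : angle (e n) t @[n --> \oo] --> l ->
    im_pow p (e n) t @[n --> \oo] --> `|t| `^ p * sin (p * l).
  move=> al; apply: cvgM; first exact: cvg_modulus_powR.
  apply: (@continuous_cvg _ _ _ \oo _ (fun n => p * angle (e n) t) (@sin R)).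
    exact: continuous_sin.
  by apply: cvgM; [exact: cvg_cst|exact: al].
move: (t0); rewrite neq_lt /tneg => /orP[tneg|tpos].
- rewrite max_l ?oppr_ge0 ?ltW// mulrC -ltr0_norm//.
  exact/h/cvg_angle_neg.
- rewrite max_r ?oppr_le0 ?ltW// powR0// mulr0 -(mulr0 (`|t| `^ p)) -sin0 -(mulr0 p).
  exact/h/cvg_angle_pos.
Qed.

End limit.
End kernel.

(** * Boundary values of the Stieltjes transform *)

Section boundary_value.
Context {R : realType}.
Local Notation RR := (measurableTypeR R).
Variable nu : probability RR R.
Implicit Types (p x y : R).

Lemma measurable_subl (g : R -> R) x : measurable_fun setT g ->
  measurable_fun setT (fun y : RR => g (x - y)).
Proof.
move=> mg; apply: (measurableT_comp mg).
by apply: measurable_funB; [exact: measurable_cst|exact: measurable_id].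
Qed.

Lemma measurable_tpos_powR p : measurable_fun setT (fun t : R => tpos t `^ p).
Proof.
apply: (@measurableT_comp _ _ _ _ _ _ (@powR R ^~ p)); first exact: measurable_powR.
by apply: measurable_maxr; [exact: measurable_id|exact: measurable_cst].
Qed.

Lemma measurable_tneg_powR p : measurable_fun setT (fun t : R => tneg t `^ p).
Proof.
apply: (@measurableT_comp _ _ _ _ _ _ (@powR R ^~ p)); first exact: measurable_powR.
by apply: measurable_maxr; [exact: oppr_measurable|exact: measurable_cst].
Qed.

Lemma measurable_norm_powR p : measurable_fun setT (fun t : R => `|t| `^ p).
Proof.
apply: (@measurableT_comp _ _ _ _ _ _ (@powR R ^~ p)); first exact: measurable_powR.
exact: normr_measurable.
Qed.

Lemma tpos_powR_le p (t : R) : p != 0 -> tpos t `^ p <= `|t| `^ p.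
Proof.
move=> p0; rewrite /tpos; have [t0|t0] := leP t 0.
  by rewrite powR0// powR_ge0.
by rewrite gtr0_norm.
Qed.

Lemma tneg_powR_le p (t : R) : p != 0 -> tneg t `^ p <= `|t| `^ p.
Proof.
move=> p0; rewrite /tneg; have [t0|t0] := leP (- t) 0.
  by rewrite powR0// powR_ge0.
by rewrite ltr0_norm// -oppr_gt0.
Qed.

Section limits.
Variables (p x : R) (G : RR -> \bar R) (e : R^nat).
Hypotheses (p0 : p != 0) (e_gt0 : forall n, 0 < e n) (e_cvg : e @ \oo --> (0 : R)).
Hypothesis xnu : {ae nu, forall y, x - y != 0}.
Hypothesis nup : nu.-integrable setT (fun y => (`|x - y| `^ p)%:E).
Hypothesis iG : nu.-integrable setT G.
Hypothesis GE : {ae nu, forall y, forall n,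
  ((modulus (e n) (x - y) `^ p)%:E <= G y)%E}.

Lemma integrable_tpos : nu.-integrable setT (fun y => (tpos (x - y) `^ p)%:E).
Proof.
apply: le_integrable nup => //.
  by apply/measurable_EFinP; exact: measurable_subl (measurable_tpos_powR p).
by move=> y _; rewrite !abse_EFin lee_fin [leLHS]ger0_norm ?[leRHS]ger0_norm ?powR_ge0//
  tpos_powR_le.
Qed.

Lemma integrable_tneg : nu.-integrable setT (fun y => (tneg (x - y) `^ p)%:E).
Proof.
apply: le_integrable nup => //.
  by apply/measurable_EFinP; exact: measurable_subl (measurable_tneg_powR p).
by move=> y _; rewrite !abse_EFin lee_fin [leLHS]ger0_norm ?[leRHS]ger0_norm ?powR_ge0//
  tneg_powR_le.
Qed.

Lemma int_pos_fin : int_pos nu p x \is a fin_num.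
Proof. exact: integrable_fin_num integrable_tpos. Qed.

Lemma int_neg_fin : int_neg nu p x \is a fin_num.
Proof. exact: integrable_fin_num integrable_tneg. Qed.

(** Dominated convergence, with [G] left free because the two exponents call for different
    majorants: a positive power is largest at the largest e, a negative one at e = 0. *)
Lemma cvg_Rintegral_kernel (k : R -> R -> R) (l : R -> R) :
  (forall n, measurable_fun setT (k (e n))) -> measurable_fun setT l ->
  (forall n t, `|k (e n) t| <= modulus (e n) t `^ p) ->
  (forall t, t != 0 -> k (e n) t @[n --> \oo] --> l t) ->
  (forall n, nu.-integrable setT (fun y => (k (e n) (x - y))%:E)) /\
  (\int[nu]_y k (e n) (x - y) @[n --> \oo] --> \int[nu]_y l (x - y)).
Proof.
move=> mk ml kE kl.
have kG : {ae nu, forall y n, setT y -> (`|(k (e n) (x - y))%:E| <= G y)%E}.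
  apply: ae_impl GE => y Gy n _; apply: le_trans (Gy n).
  by rewrite abse_EFin lee_fin.
have mk' n : measurable_fun setT (fun y : RR => (k (e n) (x - y))%:E).
  by apply/measurable_EFinP; exact: measurable_subl.
split.
  move=> n; apply/integrableP; split; first exact: mk'.
  have /integrableP[mG Goo] := iG.
  apply: le_lt_trans Goo; apply: ae_ge0_le_integral => //.
  - exact: measurableT_comp.
  - exact: measurableT_comp.
  - by apply: ae_impl kG => y Gy _; exact: le_trans (Gy n I) (lee_abs _).
have [||il _ cvgl] := @dominated_convergence _ _ _ nu _ measurableT
  (fun n y => (k (e n) (x - y))%:E) (fun y => (l (x - y))%:E) G mk' _ _ iG kG.
- by apply/measurable_EFinP; exact: measurable_subl.
- by apply: ae_impl xnu => y xy _; apply: cvg_EFin; [exact: nearW|exact: kl].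
- apply: fine_cvg; rewrite fineK; first exact: cvgl.
  exact: integrable_fin_num il.
Qed.

Lemma cvg_Rintegral_re_pow :
  (forall n, nu.-integrable setT (fun y => (re_pow p (e n) (x - y))%:E)) /\
  (\int[nu]_y re_pow p (e n) (x - y) @[n --> \oo] -->
    fine (int_pos nu p x) + cos (p * pi) * fine (int_neg nu p x)).
Proof.
have [] := @cvg_Rintegral_kernel (re_pow p)
  (fun t => tpos t `^ p + cos (p * pi) * tneg t `^ p).
- by move=> n; exact: measurable_re_pow.
- apply: measurable_funD; first exact: measurable_tpos_powR.
  by apply: measurable_funM; [exact: measurable_cst|exact: measurable_tneg_powR].
- by move=> n t; exact: norm_re_pow.
- by move=> t t0; exact: cvg_re_pow.
move=> ik icvg; split => //; move: icvg.
rewrite RintegralD//; [rewrite RintegralZl//|..] => //.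
- exact: integrable_tneg.
- exact: integrable_tpos.
- by have := integrableZl measurableT (cos (p * pi)) integrable_tneg.
Qed.

Lemma cvg_Rintegral_im_pow :
  (forall n, nu.-integrable setT (fun y => (im_pow p (e n) (x - y))%:E)) /\
  (\int[nu]_y im_pow p (e n) (x - y) @[n --> \oo] -->
    sin (p * pi) * fine (int_neg nu p x)).
Proof.
have [] := @cvg_Rintegral_kernel (im_pow p) (fun t => sin (p * pi) * tneg t `^ p).
- by move=> n; exact: measurable_im_pow.
- by apply: measurable_funM; [exact: measurable_cst|exact: measurable_tneg_powR].
- by move=> n t; exact: norm_im_pow.
- by move=> t t0; exact: cvg_im_pow.
by move=> ik icvg; split => //; rewrite -RintegralZl//; exact: integrable_tneg.
Qed.

End limits.
End boundary_value.

(** * Bounds on the imaginary part of the ratio, uniform in e *)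

Section stieltjes_ratio.
Context {R : realType}.
Local Notation RR := (measurableTypeR R).
Variable nu : probability RR R.
Variables (M b : R).
Hypotheses (nuM : {ae nu, forall y, `|y| <= M}) (b01 : 0 < b < 1).

Let b0 : 0 < b. Proof. by case/andP: b01. Qed.
Let bneq0 : b != 0. Proof. by rewrite gt_eqF. Qed.
Let b1neq0 : b - 1 != 0.
Proof. by case/andP: b01 => _ ?; rewrite lt_eqF// subr_lt0. Qed.

Lemma modulus_powR_le e x : 0 <= e ->
  {ae nu, forall y : RR, modulus e (x - y) `^ b <= (`|x| + M + e) `^ b}.
Proof.
move=> e0; apply: ae_impl nuM => y yM.
have h : modulus e (x - y) <= `|x| + M + e.
  rewrite (le_trans (modulus_le _ e0))// lerD2r (le_trans (ler_normB _ _))//.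
  by rewrite lerD2l.
apply: ge0_ler_powR; [exact: ltW|by rewrite nnegrE sqrtr_ge0| |exact: h].
by rewrite nnegrE (le_trans _ h)// sqrtr_ge0.
Qed.

Lemma integrable_modulus_powR e x : 0 <= e ->
  nu.-integrable setT (fun y => (modulus e (x - y) `^ b)%:E).
Proof.
move=> e0; have mm : measurable_fun setT (fun y : RR => (modulus e (x - y) `^ b)%:E).
  by apply/measurable_EFinP; exact: measurable_subl (measurable_modulus_powR b e).
apply/integrableP; split => //.
apply: (@le_lt_trans _ _ (\int[nu]_y (cst ((`|x| + M + e) `^ b)%:E y))%E).
  apply: ae_ge0_le_integral => //.
  - exact: measurableT_comp.
  - by move=> y _; rewrite lee_fin powR_ge0.
  - apply: ae_impl (modulus_powR_le x e0) => y h _.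
    by rewrite abse_EFin lee_fin ger0_norm ?powR_ge0.
rewrite integral_cst//; by rewrite [X in (_ * X)%E]probability_setT mule1 ltry.
Qed.

Lemma integrable_norm_powR x : nu.-integrable setT (fun y => (`|x - y| `^ b)%:E).
Proof.
have := integrable_modulus_powR x (lexx 0).
apply: eq_integrable => // y _.
by rewrite /modulus expr0n addr0 sqrtr_sqr.
Qed.

(* The imaginary part of the right-hand side of the formula for the Stieltjes
   transform of [mu], at the point [x +i* e]. *)
Definition im_ratio e x : R :=
  let N1 := \int[nu]_y re_pow (b - 1) e (x - y) in
  let N2 := \int[nu]_y im_pow (b - 1) e (x - y) in
  let D1 := \int[nu]_y re_pow b e (x - y) in
  let D2 := \int[nu]_y im_pow b e (x - y) in
  (N1 * D2 - N2 * D1) / (D1 ^+ 2 + D2 ^+ 2).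

Let kappa := cos (b * pi / 2).

Lemma kappa_gt0 : 0 < kappa.
Proof.
apply: cos_gt0_pihalf; have p0 := @pi_gt0 R; have /andP[_ b1] := b01.
rewrite (@lt_trans _ _ 0) ?oppr_lt0 ?divr_gt0 ?mulr_gt0//=.
by rewrite ltr_pM2r ?invr_gt0// gtr_pMl.
Qed.

(** The angle lies in [0, b pi], hence within b pi / 2 of the midpoint, and [cos] is even and
    decreasing on [0, pi]. *)
Lemma le_cos_angle e t : 0 < e -> kappa <= cos (b * angle e t - b * pi / 2).
Proof.
move=> e0; have /andP[t0 tpi] := angle_itv t e0; have p0 := @pi_gt0 R.
have /andP[_ b1] := b01.
rewrite -(cos_norm (_ - _)) /kappa.
have bt0 : 0 <= b * angle e t by rewrite mulr_ge0// ltW.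
have btpi : b * angle e t <= b * pi by rewrite ler_wpM2l// ltW.
have bpipi : b * pi <= pi by rewrite ger_pMl// ltW.
set u := `|_|; have ub : u <= b * pi / 2.
  rewrite ler_norml; apply/andP; split; lra.
have bpi : b * pi / 2 <= pi by lra.
rewrite leNgt ltr_cos ?in_itv/= ?normr_ge0 ?(le_trans ub)// -?leNgt//.
by rewrite divr_ge0// mulr_ge0// ltW.
Qed.

Lemma le_Rintegral_pow (k : R -> R) p e x :
  measurable_fun setT k -> (forall t, `|k t| <= modulus e t `^ p) ->
  nu.-integrable setT (fun y => (modulus e (x - y) `^ p)%:E) ->
  nu.-integrable setT (fun y => (k (x - y))%:E) /\
  `|\int[nu]_y k (x - y)| <= \int[nu]_y modulus e (x - y) `^ p.
Proof.
move=> mk kE im.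
have ik : nu.-integrable setT (fun y => (k (x - y))%:E).
  apply: le_integrable im => //.
    by apply/measurable_EFinP; exact: measurable_subl.
  by move=> y _; rewrite !abse_EFin lee_fin [leRHS]ger0_norm ?powR_ge0.
split => //; apply: (le_trans (le_normr_Rintegral measurableT ik)).
by apply: le_Rintegral => //; exact: integrable_norm.
Qed.

Section fixed_point.
Variable x : R.
Hypothesis xnu : {ae nu, forall y, x - y != 0}.
Hypothesis nux : nu.-integrable setT (fun y => (`|x - y| `^ (b - 1))%:E).
Variable c : R.
Hypotheses (c0 : 0 < c) (cx : (c%:E <= \int[nu]_y (`|x - y| `^ b)%:E)%E).

(** The exponent is negative, so the larger modulus has the smaller power. At y = x the right-hand
    side is 0 by convention and the inequality fails; hence the assumption that x is not an atom. *)
Lemma modulus_powRB1_le :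
  {ae nu, forall y : RR, forall e, 0 < e ->
    modulus e (x - y) `^ (b - 1) <= `|x - y| `^ (b - 1)}.
Proof.
apply: ae_impl xnu => y xy e e0.
have -> : b - 1 = - (1 - b) by rewrite opprB.
rewrite !powRN lef_pV2 ?posrE ?powR_gt0 ?normr_gt0 ?modulus_gt0//.
apply: ge0_ler_powR; rewrite ?nnegrE ?sqrtr_ge0 ?ler_norm_modulus//.
by case/andP: b01 => _ /ltW; rewrite subr_ge0.
Qed.

Lemma integrable_modulus_powRB1 e : 0 < e ->
  nu.-integrable setT (fun y => (modulus e (x - y) `^ (b - 1))%:E) /\
  \int[nu]_y modulus e (x - y) `^ (b - 1) <= \int[nu]_y `|x - y| `^ (b - 1).
Proof.
move=> e0.
have mm : measurable_fun setT (fun y : RR => (modulus e (x - y) `^ (b - 1))%:E).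
  by apply/measurable_EFinP; exact: measurable_subl (measurable_modulus_powR _ e).
have [mn noo] := integrableP _ _ _ nux.
have le_int : (\int[nu]_y (modulus e (x - y) `^ (b - 1))%:E <=
               \int[nu]_y (`|x - y| `^ (b - 1))%:E)%E.
  apply: ae_ge0_le_integral => //.
    by move=> y _; rewrite lee_fin powR_ge0.
  by apply: (ae_impl _ modulus_powRB1_le) => y h _; rewrite lee_fin; exact: h.
have im : nu.-integrable setT (fun y => (modulus e (x - y) `^ (b - 1))%:E).
  apply/integrableP; split => //.
  under eq_integral do rewrite gee0_abs ?lee_fin ?powR_ge0//.
  apply: le_lt_trans le_int _.
  by move: noo; under eq_integral do rewrite gee0_abs ?lee_fin ?powR_ge0//.
split => //; rewrite /Rintegral fine_le//.
- exact: integrable_fin_num im.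
- exact: integrable_fin_num nux.
Qed.

Lemma le_integral_modulus e : 0 < e -> c <= \int[nu]_y modulus e (x - y) `^ b.
Proof.
move=> e0; rewrite -lee_fin fineK; last first.
  exact: integrable_fin_num (integrable_modulus_powR x (ltW e0)).
apply: (le_trans cx); apply: ge0_le_integral => //.
- by apply/measurable_EFinP; exact: measurable_subl (measurable_norm_powR b).
- by apply/measurable_EFinP; exact: measurable_subl (measurable_modulus_powR b e).
- move=> y _; rewrite lee_fin; apply: ge0_ler_powR;
    rewrite ?nnegrE ?sqrtr_ge0 ?ler_norm_modulus//.
  exact: ltW.
Qed.

(* Rotating by the half angle [- b pi / 2] puts all the values of
   [(z - y)^b] in the cone where the real part is at least [kappa |z - y|^b]. *)
Lemma denominator_ge e : 0 < e ->
  (kappa * \int[nu]_y modulus e (x - y) `^ b) ^+ 2 <=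
  (\int[nu]_y re_pow b e (x - y)) ^+ 2 + (\int[nu]_y im_pow b e (x - y)) ^+ 2.
Proof.
move=> e0; set D1 := \int[nu]_y (re_pow b e (x - y)).
set D2 := \int[nu]_y (im_pow b e (x - y)).
have im := integrable_modulus_powR x (ltW e0).
have [i1 _] := le_Rintegral_pow (measurable_re_pow b e0) (norm_re_pow b e) im.
have [i2 _] := le_Rintegral_pow (measurable_im_pow b e0) (norm_im_pow b e) im.
set k := kappa; set s := sin (b * pi / 2).
have ks : k ^+ 2 + s ^+ 2 = 1 by exact: cos2Dsin2.
have i1k : nu.-integrable setT (EFin \o (fun y => k * re_pow b e (x - y))).
  by have := integrableZl measurableT k i1.
have i2s : nu.-integrable setT (EFin \o (fun y => s * im_pow b e (x - y))).
  by have := integrableZl measurableT s i2.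
have : k * \int[nu]_y modulus e (x - y) `^ b <= k * D1 + s * D2.
  rewrite -!RintegralZl// -RintegralD//; apply: le_Rintegral => //.
  - by have := integrableZl measurableT k im.
  - by have := integrableD measurableT i1k i2s.
  - move=> y _; rewrite /re_pow /im_pow.
    have := le_cos_angle (x - y) e0; rewrite cosB -/k -/s => h.
    have := powR_ge0 (modulus e (x - y)) b.
    move=> /ler_wpM2l/(_ _ _ h); rewrite mulrC => /le_trans; apply.
    by rewrite le_eqVlt; apply/orP; left; apply/eqP; rewrite /k /kappa /s; ring.
have : 0 <= k * \int[nu]_y modulus e (x - y) `^ b.
  apply: mulr_ge0; first exact/ltW/kappa_gt0.
  exact: le_trans (ltW c0) (le_integral_modulus e0).
move=> u0 uD; apply: (@le_trans _ _ ((k * D1 + s * D2) ^+ 2)).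
  by rewrite lerXn2r// nnegrE// (le_trans u0).
(* Cauchy-Schwarz for the unit vector (k, s), in the form of Lagrange's identity. *)
have -> : (k * D1 + s * D2) ^+ 2 =
  (k ^+ 2 + s ^+ 2) * (D1 ^+ 2 + D2 ^+ 2) - (k * D2 - s * D1) ^+ 2 by ring.
by rewrite ks mul1r gerDl oppr_le0 sqr_ge0.
Qed.

(** With I1 and I the integrals of the moduli for the exponents b - 1 and b, the numerator is at
    most 2 I1 I and the denominator at least (kappa I)^2. One factor I cancels and the other is at
    least [c], so no upper bound on I enters. *)
Lemma im_ratio_le e : 0 < e ->
  `|im_ratio e x| <= 2 / (kappa ^+ 2 * c) * \int[nu]_y `|x - y| `^ (b - 1).
Proof.
move=> e0; rewrite /im_ratio.
have [im1 J1] := integrable_modulus_powRB1 e0.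
have im := integrable_modulus_powR x (ltW e0).
have [_ D1] := le_Rintegral_pow (measurable_re_pow b e0) (norm_re_pow b e) im.
have [_ D2] := le_Rintegral_pow (measurable_im_pow b e0) (norm_im_pow b e) im.
have [_ N1] :=
  le_Rintegral_pow (measurable_re_pow (b - 1) e0) (norm_re_pow (b - 1) e) im1.
have [_ N2] :=
  le_Rintegral_pow (measurable_im_pow (b - 1) e0) (norm_im_pow (b - 1) e) im1.
have := denominator_ge e0; have := le_integral_modulus e0; move: D1 D2 N1 N2 J1.
set I := \int[nu]_y (modulus e (x - y) `^ b).
set I1 := \int[nu]_y (modulus e (x - y) `^ (b - 1)).
set J := \int[nu]_y (`|x - y| `^ (b - 1)).
set D1 := \int[nu]_y (re_pow b e (x - y)).
set D2 := \int[nu]_y (im_pow b e (x - y)).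
set N1 := \int[nu]_y (re_pow (b - 1) e (x - y)).
set N2 := \int[nu]_y (im_pow (b - 1) e (x - y)).
move=> D1I D2I N1I N2I IJ cI DI; have k0 := kappa_gt0.
have I0 : 0 < I by exact: lt_le_trans cI.
have kI : 0 < (kappa * I) ^+ 2 by rewrite exprn_gt0// mulr_gt0.
have I10 : 0 <= I1 by exact: le_trans N1I.
have num : `|N1 * D2 - N2 * D1| <= 2 * I1 * I.
  rewrite (le_trans (ler_normB _ _))// !normrM -mulrA mulr_natl mulr2n.
  by apply: lerD; apply: ler_pM.
rewrite normrM normfV (@ger0_norm _ (_ ^+ 2 + _)) ?(le_trans (ltW kI))//.
apply: (@le_trans _ _ (2 * I1 * I / (kappa * I) ^+ 2)).
  apply: ler_pM num _ => //; first by rewrite invr_ge0 (le_trans (ltW kI)).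
  by rewrite lef_pV2 ?posrE// (lt_le_trans kI).
have -> : 2 * I1 * I / (kappa * I) ^+ 2 = 2 / kappa ^+ 2 * (I1 / I).
  by field; rewrite !gt_eqF.
have -> : 2 / (kappa ^+ 2 * c) * J = 2 / kappa ^+ 2 * (J / c).
  by field; rewrite !gt_eqF.
rewrite ler_pM2l ?divr_gt0 ?exprn_gt0//.
apply: ler_pM => //; first by rewrite invr_ge0 ltW.
by rewrite lef_pV2.
Qed.

End fixed_point.
End stieltjes_ratio.

(** * Identification of the boundary value with the density *)

Section stieltjes_limit.
Context {R : realType}.
Local Notation RR := (measurableTypeR R).
Variable nu : probability RR R.
Variables (M b : R).
Hypotheses (nuM : {ae nu, forall y, `|y| <= M}) (b01 : 0 < b < 1).

Let b0 : 0 < b. Proof. by case/andP: b01. Qed.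
Let bneq0 : b != 0. Proof. by rewrite gt_eqF. Qed.
Let b1neq0 : b - 1 != 0.
Proof. by case/andP: b01 => _ ?; rewrite lt_eqF// subr_lt0. Qed.

(** For k = cos t the form is |A + exp(i t) B|^2, diagonal in A + B and A - B. The value k = -1 is
    excluded because the form then vanishes at A = B. *)
Lemma sqr_mix_gt0 (A B k : R) : 0 <= A -> 0 <= B -> 0 < A + B -> -1 < k <= 1 ->
  0 < A ^+ 2 + B ^+ 2 + 2 * k * A * B.
Proof.
move=> A0 B0 AB /andP[k0 k1].
rewrite -(pmulr_rgt0 _ (ltr0n _ 2)).
have -> : 2 * (A ^+ 2 + B ^+ 2 + 2 * k * A * B) =
  (1 + k) * (A + B) ^+ 2 + (1 - k) * (A - B) ^+ 2 by ring.
apply: ltr_wpDr; first by rewrite mulr_ge0 ?sqr_ge0// subr_ge0.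
by rewrite mulr_gt0 ?exprn_gt0//; lra.
Qed.

(** Here t = b pi: the denominator tends to A + exp(i t) B, and the numerator to a - exp(i t) b',
    the sign coming from the exponent b - 1. In the imaginary part the terms in cos t sin t b' B
    cancel, which leaves sin t (A b' + B a). *)
Lemma cvg_im_quotient (N1 N2 D1 D2 : R^nat) (A B a b' t : R) :
  N1 @ \oo --> a + - cos t * b' -> N2 @ \oo --> - sin t * b' ->
  D1 @ \oo --> A + cos t * B -> D2 @ \oo --> sin t * B ->
  0 < A ^+ 2 + B ^+ 2 + 2 * cos t * A * B ->
  (N1 n * D2 n - N2 n * D1 n) / (D1 n ^+ 2 + D2 n ^+ 2) @[n --> \oo] -->
  pi * (sin t / pi * ((A * b' + B * a) * (A ^+ 2 + B ^+ 2 + 2 * cos t * A * B)^-1)).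
Proof.
set C := cos t; set S := sin t => N1l N2l D1l D2l den0.
have CS : C ^+ 2 + S ^+ 2 = 1 by exact: cos2Dsin2.
have denE : (A + C * B) ^+ 2 + (S * B) ^+ 2 = A ^+ 2 + B ^+ 2 + 2 * C * A * B.
  transitivity (A ^+ 2 + (C ^+ 2 + S ^+ 2) * B ^+ 2 + 2 * C * A * B); first by ring.
  by rewrite CS mul1r.
have -> : pi * (S / pi * ((A * b' + B * a) / (A ^+ 2 + B ^+ 2 + 2 * C * A * B))) =
  ((a + - C * b') * (S * B) - (- S * b') * (A + C * B)) /
  ((A + C * B) ^+ 2 + (S * B) ^+ 2).
  rewrite mulrA [pi * _]mulrC divfK ?gt_eqF ?pi_gt0//.
  by rewrite denE mulrA; congr (_ / _); ring.
apply: cvgM.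
  by apply: cvgB; apply: cvgM.
apply: cvgV; first by rewrite denE gt_eqF.
by apply: cvgD; rewrite expr2; under eq_fun do rewrite expr2; apply: cvgM.
Qed.

Lemma cos_bpi : -1 < cos (b * pi) <= 1.
Proof.
rewrite cos_le1 andbT -cospi; have p0 := @pi_gt0 R; have /andP[_ b1] := b01.
have bpi : b * pi < pi by rewrite gtr_pMl.
by rewrite ltr_cos// in_itv/= ?lexx ?ltW// mulr_gt0.
Qed.

Variable c : R.
Hypothesis c0 : 0 < c.
Hypothesis cE : forall x : R, (c%:E <= \int[nu]_y (`|x - y| `^ b)%:E)%E.

Lemma int_pos_b_fin x : int_pos nu b x \is a fin_num.
Proof. exact: int_pos_fin (integrable_norm_powR nuM b01 x). Qed.

Lemma int_neg_b_fin x : int_neg nu b x \is a fin_num.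
Proof. exact: int_neg_fin (integrable_norm_powR nuM b01 x). Qed.

Lemma fine_int_pos_ge0 p (x : R) : 0 <= fine (int_pos nu p x).
Proof. by apply/fine_ge0/integral_ge0 => y _; rewrite lee_fin powR_ge0. Qed.

Lemma fine_int_neg_ge0 p (x : R) : 0 <= fine (int_neg nu p x).
Proof. by apply/fine_ge0/integral_ge0 => y _; rewrite lee_fin powR_ge0. Qed.

(** One of the two parts of x - y is always 0, so the sum dominates the integral of |x - y|^b, which
    is at least [c]. *)
Lemma int_pos_neg_gt0 x : 0 < fine (int_pos nu b x) + fine (int_neg nu b x).
Proof.
apply: (lt_le_trans c0).
rewrite -fineD; [|exact: int_pos_b_fin|exact: int_neg_b_fin].
rewrite -lee_fin fineK; last first.
  by rewrite fin_numD; apply/andP; split; [exact: int_pos_b_fin|exact: int_neg_b_fin].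
apply: (le_trans (cE x)); rewrite -ge0_integralD//; last 4 first.
- by move=> y _; rewrite lee_fin powR_ge0.
- by apply/measurable_EFinP; exact: measurable_subl (measurable_tpos_powR b).
- by move=> y _; rewrite lee_fin powR_ge0.
- by apply/measurable_EFinP; exact: measurable_subl (measurable_tneg_powR b).
apply: ge0_le_integral => //.
- by apply/measurable_EFinP; exact: measurable_subl (measurable_norm_powR b).
- apply: emeasurable_funD; apply/measurable_EFinP.
    exact: measurable_subl (measurable_tpos_powR b).
  exact: measurable_subl (measurable_tneg_powR b).
move=> y _; rewrite -EFinD lee_fin /tpos /tneg.
have [t0|t0] := leP (x - y) 0.
  rewrite powR0// add0r max_l ?oppr_ge0// ler0_norm//.
have t1 : - (x - y) <= 0 by rewrite oppr_le0 ltW.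
by rewrite gtr0_norm// (max_r t1) powR0// addr0.
Qed.

Definition density_den x : R :=
  fine (int_pos nu b x) ^+ 2 + fine (int_neg nu b x) ^+ 2 +
  2 * cos (b * pi) * fine (int_pos nu b x) * fine (int_neg nu b x).

Lemma density_den_gt0 x : 0 < density_den x.
Proof.
apply: sqr_mix_gt0; [exact: fine_int_pos_ge0|exact: fine_int_neg_ge0| |exact: cos_bpi].
exact: int_pos_neg_gt0.
Qed.

(** The two integrals of exponent b are finite and the denominator is positive at every x, so the
    extended division is a multiplication by a real number; only the integrals of exponent b - 1 can
    be infinite. *)
Lemma limit_densityE x : limit_density nu (2 * b) x =
  ((sin (b * pi) / pi)%:E *
   ((int_pos nu b x * int_neg nu (b - 1) x +
     int_neg nu b x * int_pos nu (b - 1) x) *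
    (density_den x)^-1%:E))%E.
Proof.
rewrite /limit_density.
have -> : 2 * b / 2 = b by field.
have -> : 2 * b * pi / 2 = b * pi by field.
have -> : (int_pos nu b x ^+ 2 + int_neg nu b x ^+ 2 +
    (2 * cos (b * pi))%:E * int_pos nu b x * int_neg nu b x =
    (density_den x)%:E)%E.
  rewrite /density_den; have := int_pos_b_fin x; have := int_neg_b_fin x.
  by case: (int_pos nu b x) => // A; case: (int_neg nu b x).
by rewrite inver gt_eqF//; exact: density_den_gt0.
Qed.

Section fixed_point.
Variable x : R.
Hypothesis xnu : {ae nu, forall y, x - y != 0}.
Hypothesis nux : nu.-integrable setT (fun y => (`|x - y| `^ (b - 1))%:E).
Variable e : R^nat.
Hypotheses (e_gt0 : forall n, 0 < e n) (e_cvg : e @ \oo --> (0 : R)).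
Hypothesis e_le1 : forall n, e n <= 1.

Lemma cvg_im_ratio :
  (im_ratio nu b (e n) x)%:E @[n --> \oo] --> (pi%:E * limit_density nu (2 * b) x)%E.
Proof.
have nuxb := integrable_norm_powR nuM b01 x.
have iG : nu.-integrable setT (fun y => (modulus 1 (x - y) `^ b)%:E).
  by apply: (integrable_modulus_powR nuM b01).
have GE : {ae nu, forall y, forall n,
    ((modulus (e n) (x - y) `^ b)%:E <= (modulus 1 (x - y) `^ b)%:E)%E}.
  apply: aeW => y n; rewrite lee_fin; apply: ge0_ler_powR; rewrite ?nnegrE ?sqrtr_ge0//.
    exact: ltW.
  by rewrite ler_wsqrtr// lerD2l lerXn2r// nnegrE// ltW.
have GE1 : {ae nu, forall y, forall n,
    ((modulus (e n) (x - y) `^ (b - 1))%:E <= (`|x - y| `^ (b - 1))%:E)%E}.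
  apply: (ae_impl _ (modulus_powRB1_le b01 xnu)) => y h n.
  by rewrite lee_fin; exact: h.
have [_ D1] := cvg_Rintegral_re_pow bneq0 e_gt0 e_cvg xnu nuxb iG GE.
have [_ D2] := cvg_Rintegral_im_pow bneq0 e_gt0 e_cvg xnu nuxb iG GE.
have [_ N1] := cvg_Rintegral_re_pow b1neq0 e_gt0 e_cvg xnu nux nux GE1.
have [_ N2] := cvg_Rintegral_im_pow b1neq0 e_gt0 e_cvg xnu nux nux GE1.
have cosB1 : cos ((b - 1) * pi) = - cos (b * pi).
  by rewrite mulrBl mul1r cosB cospi sinpi mulr0 addr0 mulrN1.
have sinB1 : sin ((b - 1) * pi) = - sin (b * pi).
  by rewrite mulrBl mul1r sinB cospi sinpi mulr0 subr0 mulrN1.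
have den0 := density_den_gt0 x.
have afin := int_pos_fin b1neq0 nux; have bfin := int_neg_fin b1neq0 nux.
rewrite limit_densityE -(fineK (int_pos_b_fin x)) -(fineK (int_neg_b_fin x)).
rewrite -(fineK afin) -(fineK bfin) -!(EFinM, EFinD).
apply: cvg_EFin; first exact: nearW.
rewrite cosB1 sinB1 in N1 N2.
exact: (cvg_im_quotient N1 N2 D1 D2 den0).
Qed.

End fixed_point.
End stieltjes_limit.

(** * Local integrability of the potential *)

Section singular_kernel.
Context {R : realType}.
Local Notation RR := (measurableTypeR R).
Implicit Types (e p q t x y : R).

Lemma is_derive_continuous (F : R -> R) x l : is_derive x 1 F l -> {for x, continuous F}.
Proof. by move=> dF; apply/differentiable_continuous/derivable1_diffP; exact: ex_derive. Qed.

Lemma integral_is_derive (f F : R -> R) p q : p < q ->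
  continuous f -> (forall x, is_derive x 1 F (f x)) ->
  (\int[lebesgue_measure]_(x in `[p, q]) (f x)%:E = (F q - F p)%:E)%E.
Proof.
move=> pq cf dF; have cF x := is_derive_continuous (dF x).
rewrite (@continuous_FTC2 _ _ F)//.
- exact: continuous_subspaceT.
- split.
  + by move=> x _; exact: ex_derive.
  + by apply: cvg_at_right_filter; exact: cF.
  + by apply: cvg_at_left_filter; exact: cF.
- by move=> x _; rewrite derive1E; exact: derive_val.
Qed.

Lemma modulus_powRE p e t : modulus e t `^ p = (t ^+ 2 + e ^+ 2) `^ (p / 2).
Proof.
by rewrite /modulus -powR12_sqrt ?addr_ge0 ?sqr_ge0// -powRrM mulrC.
Qed.

Lemma is_derive_sqr_powR e c t : 0 < e ->
  is_derive t 1 (fun t => (t ^+ 2 + e ^+ 2) `^ c)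
    (c * (t ^+ 2 + e ^+ 2) `^ (c - 1) * (2 * t)).
Proof.
move=> e0; have h : 0 < t ^+ 2 + e ^+ 2 by rewrite ltr_wpDl ?sqr_ge0// exprn_gt0.
have d1 : is_derive t 1 (fun t => t ^+ 2 + e ^+ 2) (2 * t).
  by apply: is_derive_eq; rewrite addr0 /GRing.scale/= mulr1 mulr_natl mulr2n.
have := @is_derive1_comp _ (fun u => u `^ c) (fun t => t ^+ 2 + e ^+ 2) t _ _
  (is_derive1_powR c h) d1.
by [].
Qed.

Section primitive.
Variables (b e y : R).
Hypotheses (b01 : 0 < b < 1) (e0 : 0 < e).

(* [|x - y| `^ (b - 1)] is singular at [y], but its regularization
   [modulus e (x - y) `^ (b - 1)] is, up to the factor [b], at most the
   derivative of the smooth function [P], which is bounded uniformly in [e]. *)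
Let P x := (x - y) * modulus e (x - y) `^ (b - 1).
(** This is [modulus] to the power 2 c, written over a positive polynomial so that no square root is
    differentiated. *)
Let w c x := ((x - y) ^+ 2 + e ^+ 2) `^ c.
Let P' x := w ((b - 1) / 2) x +
  (b - 1) * (w ((b - 1) / 2 - 1) x * (x - y) ^+ 2).

Let dshift x : is_derive x 1 (fun x => x - y) 1.
Proof. by apply: is_derive_eq; rewrite subr0. Qed.

Let dw c x : is_derive x 1 (w c) (c * w (c - 1) x * (2 * (x - y))).
Proof.
have := @is_derive1_comp _ _ (fun x => x - y) x _ _
  (is_derive_sqr_powR c (x - y) e0) (dshift x).
by rewrite mulr1.
Qed.

Let dP x : is_derive x 1 P (P' x).
Proof.
have -> : P = (fun x => x - y) * w ((b - 1) / 2).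
  by apply/funext => u; rewrite /P modulus_powRE.
apply: (@is_derive_eq _ _ _ _ _ _ _ _ (is_deriveM (dshift x) (dw ((b - 1) / 2) x))).
rewrite /GRing.scale/= /P' mulr1 addrC; congr (_ + _); by field.
Qed.

Let cP' : continuous P'.
Proof.
move=> x; have cw c := is_derive_continuous (dw c x).
have cs := is_derive_continuous (dshift x).
apply: cvgD; first exact: cw.
apply: cvgM; first exact: cvg_cst.
apply: cvgM; first exact: cw.
rewrite /continuous_at expr2; under eq_fun do rewrite expr2.
by apply: cvgM.
Qed.

(** The difference of the two sides is (1 - b) e^2 times the power b - 3 of the modulus. *)
Let le_P' x : b * modulus e (x - y) `^ (b - 1) <= P' x.
Proof.
have h : 0 < (x - y) ^+ 2 + e ^+ 2 by rewrite ltr_wpDl ?sqr_ge0// exprn_gt0.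
rewrite modulus_powRE /P' -/(w _ x).
have -> : w ((b - 1) / 2) x = w ((b - 1) / 2 - 1) x * ((x - y) ^+ 2 + e ^+ 2).
  rewrite /w; set T := (X in _ * X).
  rewrite -[X in _ = _ * X](powRr1 (ltW h)) -powRD; last first.
    by rewrite (gt_eqF h) implybT.
  by congr (_ `^ _); ring.
have : 0 <= w ((b - 1) / 2 - 1) x by exact: powR_ge0.
move/andP: b01 => [b0 b1]; have e2 : 0 < e ^+ 2 by rewrite exprn_gt0.
move: (w _ _) => u u0; rewrite -subr_ge0.
have -> : u * ((x - y) ^+ 2 + e ^+ 2) + (b - 1) * (u * (x - y) ^+ 2) -
  b * (u * ((x - y) ^+ 2 + e ^+ 2)) = u * ((1 - b) * e ^+ 2) by ring.
by rewrite mulr_ge0// mulr_ge0 ?ltW// subr_gt0.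
Qed.

(** The factor |x - y| is at most the modulus and raises the exponent from b - 1 to b > 0, which
    removes the blow-up as e tends to 0. *)
Let normP_le L x : `|x - y| <= L -> `|P x| <= (L + e) `^ b.
Proof.
move=> xL; rewrite /P normrM (@ger0_norm _ (_ `^ _)) ?powR_ge0//.
have m0 := modulus_gt0 (x - y) e0.
apply: (@le_trans _ _ (modulus e (x - y) * modulus e (x - y) `^ (b - 1))).
  by rewrite ler_wpM2r ?powR_ge0// ler_norm_modulus.
rewrite -{1}(powRr1 (ltW m0)) -powRD; last by rewrite (gt_eqF m0) implybT.
have -> : 1 + (b - 1) = b by ring.
have mL : modulus e (x - y) <= L + e.
  by rewrite (le_trans (modulus_le _ (ltW e0)))// lerD2r.
apply: ge0_ler_powR => //; first by case/andP: b01 => /ltW.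
- by rewrite nnegrE ltW.
- by rewrite nnegrE (le_trans (ltW m0)).
Qed.

Lemma integral_modulus_powRB1_le p q L : p < q -> `|p - y| <= L -> `|q - y| <= L ->
  (\int[lebesgue_measure]_(x in `[p, q]) (modulus e (x - y) `^ (b - 1))%:E <=
   (2 / b * (L + e) `^ b)%:E)%E.
Proof.
move=> pq pL qL; have /andP[b0 b1] := b01.
have mm : measurable_fun setT (fun x : R => modulus e (x - y) `^ (b - 1)).
  apply: (measurableT_comp (measurable_modulus_powR (b - 1) e)).
  by apply: measurable_funB; [exact: measurable_id|exact: measurable_cst].
apply: (@le_trans _ _ (\int[lebesgue_measure]_(x in `[p, q]) (b^-1 * P' x)%:E)%E).
  apply: ge0_le_integral => //=.
  - by move=> x _; rewrite lee_fin powR_ge0.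
  - exact/measurable_EFinP/measurable_funTS.
  - apply/measurable_EFinP/measurable_funTS.
    apply: measurable_funM; first exact: measurable_cst.
    exact: continuous_measurable_fun.
  - by move=> x _; rewrite lee_fin -ler_pdivrMl ?invr_gt0// invrK.
have dQ x : is_derive x 1 (fun x => b^-1 * P x) (b^-1 * P' x).
  have dPx := dP x.
  apply: (@is_derive_eq _ _ _ _ _ _ _ _ (is_deriveM (is_derive_cst (b^-1) x 1) dPx)).
  by rewrite scaler0 addr0.
rewrite (integral_is_derive pq _ dQ); last first.
  by move=> x; apply: cvgM; [exact: cvg_cst|exact: cP'].
rewrite lee_fin -mulrBr (mulrC 2) -mulrA ler_pM2l ?invr_gt0//.
have := normP_le pL; have := normP_le qL; rewrite !ler_norml.
by move=> /andP[? ?] /andP[? ?]; lra.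
Qed.

End primitive.
End singular_kernel.

Section singular_kernel_integral.
Context {R : realType}.
Local Notation RR := (measurableTypeR R).
Local Notation leb := (@lebesgue_measure R).
Implicit Types (e p q t x y : R).
Variable b : R.
Hypothesis b01 : 0 < b < 1.

Lemma measurable_dist_powR : 
  measurable_fun setT (fun xy : RR * RR => `|xy.1 - xy.2| `^ (b - 1)).
Proof.
apply: (measurableT_comp (measurable_norm_powR (b - 1))).
by apply: measurable_funB; [exact: measurable_fst|exact: measurable_snd].
Qed.

(** Fatou's lemma carries the bound on the regularized kernels to e = 0. It only needs the kernel to
    lie below the lower limit, which at x = y holds because the power of 0 is 0. *)
Lemma integral_norm_powRB1_le p q y L : p < q -> `|p - y| <= L -> `|q - y| <= L ->
  (\int[leb]_(x in `[p, q]) (`|x - y| `^ (b - 1))%:E <= (2 / b * (L + 1) `^ b)%:E)%E.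
Proof.
move=> pq pL qL; have /andP[b0 b1] := b01.
pose e (n : nat) : R := n.+1%:R^-1.
have e0 n : 0 < e n by rewrite invr_gt0.
have e1 n : e n <= 1 by rewrite invf_le1// ler1n.
have ecvg : e @ \oo --> (0 : R) by exact: cvg_harmonic.
have mm n : measurable_fun setT (fun x : RR => (modulus (e n) (x - y) `^ (b - 1))%:E).
  apply/measurable_EFinP/(measurableT_comp (measurable_modulus_powR (b - 1) (e n))).
  by apply: measurable_funB; [exact: measurable_id|exact: measurable_cst].
pose k n (x : RR) := (modulus (e n) (x - y) `^ (b - 1))%:E.
have := @fatou _ _ R leb `[p, q]%classic (measurable_itv _) k.
move=> /(_ (fun n => measurable_funTS (mm n))) fatouk.
apply: (@le_trans _ _ (\int[leb]_(x in `[p, q]) limn_einf (k ^~ x))%E).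
  apply: ge0_le_integral => //.
  - apply/measurable_EFinP/measurable_funTS.
    apply: (measurableT_comp (measurable_norm_powR (b - 1))).
    by apply: measurable_funB; [exact: measurable_id|exact: measurable_cst].
  - rewrite /limn_einf; apply: (measurableT_comp (@oppe_measurable _ setT)).
    apply: measurable_fun_limn_esup => n.
    apply: (measurableT_comp (@oppe_measurable _ setT)).
    exact: measurable_funTS (mm n).
  - move=> x _; have [->|xy] := eqVneq x y.
      rewrite subrr normr0 powR0; last by rewrite lt_eqF// subr_lt0.
      rewrite limn_einf_lim; apply: lime_ge; first exact: is_cvg_einfs.
      apply: nearW => n; apply: le_ereal_inf_tmp => _ [m _ <-].
      by rewrite lee_fin powR_ge0.
    have kx : k n x @[n --> \oo] --> (`|x - y| `^ (b - 1))%:E.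
      apply: cvg_EFin; first exact: nearW.
      by apply: cvg_modulus_powR; rewrite ?subr_eq0.
    by have [-> _] := cvg_limn_einf_sup kx.
apply: (le_trans (fatouk _)); first by move=> n x _; rewrite lee_fin powR_ge0.
rewrite limn_einf_lim; apply: lime_le; first exact: is_cvg_einfs.
apply: nearW => n; apply: (@le_trans _ _ (\int[leb]_(x in `[p, q]) k n x)%E).
  by apply: ereal_inf_lbound; exists n => /=.
apply: (le_trans (integral_modulus_powRB1_le b01 (e0 n) pq pL qL)).
rewrite lee_fin ler_pM2l ?divr_gt0//.
have L0 : 0 <= L by exact: le_trans pL.
by apply: ge0_ler_powR; rewrite ?nnegrE ?addr_ge0 ?lerD2l// ltW.
Qed.

Variables (nu : probability RR R) (M : R).
Hypothesis nuM : {ae nu, forall y, `|y| <= M}.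

Definition potential x : \bar R := (\int[nu]_y (`|x - y| `^ (b - 1))%:E)%E.

Lemma measurable_potential : measurable_fun setT potential.
Proof.
apply: (@measurable_fun_fubini_tonelli_F _ _ RR RR R nu
  (fun xy => (`|xy.1 - xy.2| `^ (b - 1))%:E)).
  apply/measurable_EFinP. exact: measurable_dist_powR.
by move=> ?; rewrite lee_fin powR_ge0.
Qed.

Lemma potential_ge0 x : (0 <= potential x)%E.
Proof. by apply: integral_ge0 => y _; rewrite lee_fin powR_ge0. Qed.

(** By Tonelli the integral over x comes first, and it is bounded uniformly for |y| <= M. *)
Lemma integral_potential_lty p q : p < q ->
  (\int[leb]_(x in `[p, q]) potential x < +oo)%E.
Proof.
move=> pq; rewrite integral_mkcond.
(* The indicator of [p, q] is put into the kernel so that Tonelli applies on the whole plane. *)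
pose h (xy : RR * RR) : \bar R := (`|xy.1 - xy.2| `^ (b - 1) * \1_`[p, q] xy.1)%:E.
have mh : measurable_fun setT h.
  apply/measurable_EFinP; apply: measurable_funM; first exact: measurable_dist_powR.
  have mi : measurable_fun setT (\1_`[p, q] : RR -> R).
    by apply: measurable_indic; exact: measurable_itv.
  exact: (measurableT_comp mi measurable_fst).
have h0 xy : (0 <= h xy)%E by rewrite lee_fin mulr_ge0// powR_ge0.
rewrite (_ : (potential \_ `[p, q])%E = fubini_F nu h); last first.
  apply/funext => x; rewrite /fubini_F /h /= patchE indicE.
  case: ifPn => xpq; last by under eq_integral do rewrite mulr0; rewrite integral0.
  by under eq_integral do rewrite mulr1.
have := @fubini_tonelli _ _ RR RR R leb nu h mh h0 => /= ->.
(* Bounds both |p - y| and |q - y| when |y| <= M. *)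
pose L := M + `|p| + `|q|.
apply: (@le_lt_trans _ _ (\int[nu]_y (cst (2 / b * (L + 1) `^ b)%:E y))%E); last first.
  by rewrite integral_cst// [X in (_ * X)%E]probability_setT mule1 ltry.
have /andP[b0 _] := b01.
apply: ae_ge0_le_integral => //.
- by move=> y _; exact: integral_ge0.
- exact: measurable_fun_fubini_tonelli_G.
- by move=> y _; rewrite lee_fin mulr_ge0 ?powR_ge0// divr_ge0// ltW.
- apply: ae_impl nuM => y yM _; rewrite /fubini_G/= /h/=.
  rewrite (_ : (\int[_]_x _)%E = (\int[leb]_(x in `[p, q]) (`|x - y| `^ (b - 1))%:E)%E).
    apply: integral_norm_powRB1_le => //.
      rewrite (le_trans (ler_normB _ _))// /L; have := normr_ge0 q; lra.
    rewrite (le_trans (ler_normB _ _))// /L; have := normr_ge0 p; lra.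
  rewrite [RHS]integral_mkcond; apply: eq_integral => x _.
  by rewrite patchE indicE; case: ifPn; rewrite ?mulr1 ?mulr0.
Qed.

Lemma ae_potential_lty p q : p < q ->
  {ae leb, forall x, x \in `[p, q] -> (potential x < +oo)%E}.
Proof.
move=> pq.
have := @integrable_ae _ _ R leb `[p, q]%classic (measurable_itv _) potential.
have ip : leb.-integrable `[p, q] potential.
  apply/integrableP; split; first exact: measurable_funTS measurable_potential.
  by under eq_integral do rewrite gee0_abs ?potential_ge0//;
    exact: integral_potential_lty.
move=> /(_ ip); apply: ae_impl => x + xpq; move=> /(_ xpq).
by rewrite ge0_fin_numE// potential_ge0.
Qed.

(** Tonelli for the indicator of the diagonal: for fixed y the slice is one point, which is
    Lebesgue-null, so the [nu]-mass of {x} vanishes for almost every x. *)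
Lemma ae_not_atom : {ae leb, forall x, {ae nu, forall y, x - y != 0}}.
Proof.
pose h (xy : RR * RR) : \bar R := (\1_[set (0 : R)] (xy.1 - xy.2))%:E.
have mi : measurable_fun setT (\1_[set (0 : R)] : R -> R).
  by apply: measurable_indic; exact: measurable_set1.
have mh : measurable_fun setT h.
  apply/measurable_EFinP; apply: (measurableT_comp mi).
  by apply: measurable_funB; [exact: measurable_fst|exact: measurable_snd].
have h0 xy : (0 <= h xy)%E by rewrite lee_fin.
have := @fubini_tonelli _ _ RR RR R leb nu h mh h0 => /=.
rewrite [RHS](_ : _ = 0%E); last first.
  rewrite (eq_integral (cst 0%E)) ?integral0// => y _.
  rewrite /fubini_G /h/=.
  rewrite (_ : (fun x => _) = (EFin \o \1_[set y : RR])); last first.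
    apply/funext => x; rewrite /= !indicE; congr ((_ : bool)%:R%:E).
    apply/idP/idP; rewrite !inE/=; last by move=> ->; rewrite subrr.
    by move/eqP; rewrite subr_eq0 => /eqP.
  rewrite integral_indic// setIT; exact: lebesgue_measure_set1.
move=> F0.
have mF := @measurable_fun_fubini_tonelli_F _ _ RR RR R nu h mh h0.
have : ae_eq leb setT (fubini_F nu h) (cst 0%E).
  apply/(ae_eq_integral_abs leb measurableT mF).
  rewrite -[RHS]F0; apply: eq_integral => x _; rewrite gee0_abs//.
  by apply: integral_ge0.
apply: ae_impl => x /(_ I); rewrite /fubini_F/= => hx.
have : ae_eq nu setT (fun y => h (x, y)) (cst 0%E).
  apply/(ae_eq_integral_abs nu measurableT); first exact: measurableT_comp.
  by rewrite -[RHS]hx; apply: eq_integral => y _; rewrite gee0_abs.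
apply: ae_impl => y /(_ I); rewrite /h/= indicE => -[]; apply: contra_eqN => /eqP xy0.
by rewrite mem_set//= oner_neq0.
Qed.

End singular_kernel_integral.

(** * Poisson integrals *)

Section poisson.
Context {R : realType}.
Local Notation RR := (measurableTypeR R).
Local Notation leb := (@lebesgue_measure R).
Implicit Types (e p q t x y : R).

(** The Poisson kernel without its factor 1 / pi: its total mass is pi, whence the factors pi
    below. *)
Definition poisson e t : R := e / (t ^+ 2 + e ^+ 2).

Lemma poisson_ge0 e t : 0 < e -> 0 <= poisson e t.
Proof. by move=> e0; rewrite divr_ge0 ?addr_ge0 ?sqr_ge0 ?ltW. Qed.

Lemma continuous_poisson e : 0 < e -> continuous (poisson e).
Proof.
move=> e0 t; apply: cvgM; first exact: cvg_cst.
apply: cvgV; first by rewrite gt_eqF// ltr_wpDl ?sqr_ge0 ?exprn_gt0.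
by apply: cvgD; [exact: exprn_continuous|exact: cvg_cst].
Qed.

Lemma Im_inv_sub e x t : 0 < e ->
  complex.Im (t%:C - (x +i* e))^-1 = poisson e (t - x).
Proof.
by move=> e0; rewrite /poisson /= sub0r sqrrN mulNr opprK.
Qed.

Lemma Im_stieltjes (mu : {measure set RR -> \bar R}) e x : 0 < e ->
  complex.Im (stieltjes mu (x +i* e)) = \int[mu]_t poisson e (t - x).
Proof.
by move=> e0; rewrite /stieltjes /cintegral /=; apply: eq_Rintegral => t _; exact: Im_inv_sub.
Qed.

Lemma integral_poisson e p q t : 0 < e -> p < q ->
  (\int[leb]_(x in `[p, q]) (poisson e (t - x))%:E =
   (atan ((q - t) / e) - atan ((p - t) / e))%:E)%E.
Proof.
move=> e0 pq; apply: (@integral_is_derive _ _ (fun x => atan ((x - t) / e))) => //.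
  move=> x; apply: (@continuous_comp _ _ _ (fun x => t - x) (poisson e)).
    by apply: cvgB; [exact: cvg_cst|exact: cvg_id].
  exact: continuous_poisson.
move=> x.
have dx : is_derive x 1 (fun x => (x - t) / e) e^-1.
  by apply: is_derive_eq; rewrite scaler0 add0r subr0 /GRing.scale/= mulr1.
have := @is_derive1_comp _ atan (fun x => (x - t) / e) x _ _ (is_derive1_atan _) dx.
move=> d; apply: (is_derive_eq d); rewrite /poisson.
have h1 : 0 < (t - x) ^+ 2 + e ^+ 2 by rewrite ltr_wpDl ?sqr_ge0// exprn_gt0.
have h2 : 0 < 1 + ((x - t) / e) ^+ 2 by rewrite ltr_wpDr ?sqr_ge0.
have -> : 1 + ((x - t) / e) ^+ 2 = ((t - x) ^+ 2 + e ^+ 2) / e ^+ 2.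
  by field; rewrite gt_eqF.
by field; rewrite !gt_eqF.
Qed.

Let e (n : nat) : R := n.+1%:R^-1.
Let e_gt0 n : 0 < e n. Proof. by rewrite invr_gt0. Qed.

Lemma cvg_atan_sg t : atan (t / e n) @[n --> \oo] --> Num.sg t * (pi / 2).
Proof.
have pos s : 0 < s -> atan (s / e n) @[n --> \oo] --> pi / 2.
  move=> s0; suff h : s / e n @[n --> \oo] --> +oo 
    by exact: (cvg_comp _ _ h (@cvgy_atan R)).
  apply/cvgryPge => A; near=> n.
  rewrite /e invrK -ler_pdivrMl// (@le_trans _ _ n%:R)// ?ler_nat//.
  by near: n; exact: nbhs_infty_ger.
have [t0|t0|->] := ltgtP t 0.
- rewrite ltr0_sg// mulN1r.
  have -> : (fun n => atan (t / e n)) = (fun n => - atan (- t / e n)).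
    by apply/funext => n; rewrite -atanN mulNr opprK.
  by apply: cvgN; apply: pos; rewrite oppr_gt0.
- by rewrite gtr0_sg// mul1r; exact: pos.
- by rewrite sgr0 mul0r; under eq_fun do rewrite mul0r atan0; exact: cvg_cst.
Unshelve. all: by end_near. Qed.

Variable mu : probability RR R.

Lemma measurable_poisson n :
  measurable_fun setT (fun xt : RR * RR => (poisson (e n) (xt.2 - xt.1))%:E).
Proof.
apply/measurable_EFinP.
apply: (measurableT_comp (continuous_measurable_fun (continuous_poisson (e_gt0 n)))).
by apply: measurable_funB; [exact: measurable_snd|exact: measurable_fst].
Qed.

Definition poisson_integral n x : \bar R := (\int[mu]_t (poisson (e n) (t - x))%:E)%E.

Lemma measurable_poisson_integral n : measurable_fun setT (poisson_integral n).
Proof.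
apply: (@measurable_fun_fubini_tonelli_F _ _ RR RR R mu _ (measurable_poisson n)).
by move=> ?; rewrite lee_fin poisson_ge0.
Qed.

Let g n p q t : R := atan ((q - t) / e n) - atan ((p - t) / e n).

Lemma integral_poisson_integral n p q : p < q ->
  (\int[leb]_(x in `[p, q]) poisson_integral n x = \int[mu]_t (g n p q t)%:E)%E.
Proof.
move=> pq; rewrite integral_mkcond.
pose h (xt : RR * RR) : \bar R := (poisson (e n) (xt.2 - xt.1) * \1_`[p, q] xt.1)%:E.
have mh : measurable_fun setT h.
  apply/measurable_EFinP; apply: measurable_funM.
    by apply/measurable_EFinP; exact: measurable_poisson.
  have mi : measurable_fun setT (\1_`[p, q] : RR -> R).
    by apply: measurable_indic; exact: measurable_itv.
  exact: (measurableT_comp mi measurable_fst).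
have h0 xt : (0 <= h xt)%E by rewrite lee_fin mulr_ge0// poisson_ge0.
rewrite (_ : (poisson_integral n \_ `[p, q])%E = fubini_F mu h); last first.
  apply/funext => x; rewrite /fubini_F /h /= patchE indicE.
  case: ifPn => xpq; last by under eq_integral do rewrite mulr0; rewrite integral0.
  by under eq_integral do rewrite mulr1.
have := @fubini_tonelli _ _ RR RR R leb mu h mh h0 => /= ->.
apply: eq_integral => t _; rewrite /g -integral_poisson// [RHS]integral_mkcond.
apply: eq_integral => x _; rewrite /h/=.
by rewrite patchE indicE; case: ifPn; rewrite ?mulr1 ?mulr0.
Qed.

Lemma cvg_integral_poisson_integral p q : p < q ->
  exists l, [/\ 
    (\int[leb]_(x in `[p, q]) poisson_integral n x)%E @[n --> \oo] --> l,
    (pi%:E * mu `]p, q[%classic <= l)%E & (l <= pi%:E * mu `[p, q]%classic)%E].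
Proof.
move=> pq; have p0 := @pi_gt0 R.
(* This limit is pi on ]p, q[, pi / 2 at p and at q, and 0 elsewhere, hence between pi times the
   indicators of the open and of the closed interval. *)
pose G t : R := Num.sg (q - t) * (pi / 2) - Num.sg (p - t) * (pi / 2).
have cvgG t : g n p q t @[n --> \oo] --> G t.
  by apply: cvgB; exact: cvg_atan_sg.
have cvgGE t : (g n p q t)%:E @[n --> \oo] --> (G t)%:E.
  by apply: cvg_EFin; [exact: nearW|exact: cvgG].
have mg n : measurable_fun setT (fun t : RR => (g n p q t)%:E).
  apply/measurable_EFinP; apply: measurable_funB;
    apply: (@measurableT_comp _ _ _ _ _ _ atan);
    try (by apply: continuous_measurable_fun => x; exact: continuous_atan);
    by apply: measurable_funM => //; apply: measurable_funB.
have mG : measurable_fun setT (fun t : RR => (G t)%:E).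
  apply: (emeasurable_fun_cvg (fun n t => (g n p q t)%:E) _ mg) => t _.
  exact: cvgGE.
have gpi n t : `|g n p q t| <= pi.
  have := atan_ltpi2 ((q - t) / e n); have := atan_gtNpi2 ((q - t) / e n).
  have := atan_ltpi2 ((p - t) / e n); have := atan_gtNpi2 ((p - t) / e n).
  by rewrite ler_norml /g => *; apply/andP; split; lra.
have [||iG _ cvgI] := @dominated_convergence _ _ _ mu _ measurableT
  (fun n t => (g n p q t)%:E) (fun t => (G t)%:E) (cst pi%:E) mg mG _
  (finite_measure_integrable_cst mu pi measurableT) _.
- by apply: aeW => t _; exact: cvgGE.
- by apply: aeW => t n _; rewrite abse_EFin lee_fin.
have mr (D : set RR) : measurable D ->
    measurable_fun setT ((cst pi%:E : RR -> \bar R) \_ D).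
  by move=> mD; apply/(measurable_restrictT _ mD); exact: measurable_cst.
exists (\int[mu]_t (G t)%:E)%E; split.
- by under eq_fun do rewrite integral_poisson_integral//; exact: cvgI.
- rewrite -integral_cst; last exact: measurable_itv.
  rewrite integral_mkcond; apply: ge0_le_integral => //.
  + by move=> t _; apply: erestrict_ge0 => ? _; rewrite lee_fin ltW.
  + by apply: mr; exact: measurable_itv.
  + move=> t _; rewrite patchE; case: ifPn.
      rewrite inE/= in_itv/= => /andP[pt tq].
      by rewrite lee_fin /G gtr0_sg ?subr_gt0// ltr0_sg ?subr_lt0//; lra.
    move=> _; rewrite lee_fin /G.
    have [qt|qt|qt] := sgrP (q - t); have [pt|pt|pt] := sgrP (p - t); lra.
- rewrite -integral_cst; last exact: measurable_itv.
  rewrite integral_mkcond; apply: ge0_le_integral => //.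
  + move=> t _; rewrite lee_fin /G.
    have [qt|qt|qt] := sgrP (q - t); have [pt|pt|pt] := sgrP (p - t); lra.
  + by apply: mr; exact: measurable_itv.
  + move=> t _; rewrite patchE; case: ifPn.
      rewrite inE/= in_itv/= => /andP[pt tq]; rewrite lee_fin /G.
      have [qt'|qt'|qt'] := sgrP (q - t); have [pt'|pt'|pt'] := sgrP (p - t); lra.
    rewrite notin_setE/= in_itv/= => /negP; rewrite negb_and -!ltNge => /orP tpq.
    rewrite lee_fin /G.
    have [qt|qt|qt] := sgrP (q - t); have [pt|pt|pt] := sgrP (p - t); case: tpq; lra.
Qed.

End poisson.

(** * Densities and Stieltjes inversion *)

Section density_measure.
Context d (T : measurableType d) (R : realType) (m : {measure set T -> \bar R}).
Variables (f : T -> \bar R) (mf : measurable_fun setT f).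
Hypothesis f0 : forall x, (0 <= f x)%E.

(* The two proofs are arguments only so that the measure structure below can be
   inferred from the term. *)
Definition with_density of measurable_fun setT f & (forall x, (0 <= f x)%E) :=
  fun B : set T => (\int[m]_(x in B) f x)%E.

Local Notation mu := (with_density mf f0).

Let density0 : mu set0 = 0%E.
Proof. exact: integral_set0. Qed.

Let density_ge0 B : (0 <= mu B)%E.
Proof. exact: integral_ge0. Qed.

Let density_sigma_additive : semi_sigma_additive mu.
Proof.
move=> B mB tB mUB; rewrite /with_density ge0_integral_bigcup//.
  by apply: is_cvg_ereal_nneg_natsum_cond => n _ _; exact: integral_ge0.
exact: measurable_funTS.
Qed.

HB.instance Definition _ := isMeasure.Build _ _ _
  mu density0 density_ge0 density_sigma_additive.

End density_measure.

Section density_line.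
Context {R : realType}.
Local Notation RR := (measurableTypeR R).
Local Notation leb := (@lebesgue_measure R).

(* Exhausting [ ]p, q[ ] by compact subintervals turns the two inequalities into
   an equality on open intervals. *)
Lemma eq_measure_density (mu : probability RR R) (f : RR -> \bar R) :
  measurable_fun setT f -> (forall x, (0 <= f x)%E) ->
  (forall p q : R, p < q ->
    (mu `]p, q[%classic <= \int[leb]_(x in `[p, q]) f x)%E /\
    (\int[leb]_(x in `[p, q]) f x <= mu `[p, q]%classic)%E) ->
  forall B, measurable B -> mu B = (\int[leb]_(x in B) f x)%E.
Proof.
move=> mf f0 muf.
have mfS (D : set RR) : measurable_fun D f by exact: measurable_funTS.
have muE (p q : R) : mu `]p, q[%classic = (\int[leb]_(x in `]p, q[) f x)%E.
  have [pq|qp] := ltP p q; last first.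
    by rewrite set_itv_ge ?measure0 ?integral_set0// -leNgt bnd_simp.
  apply/eqP; rewrite eq_le; apply/andP; split.
    rewrite -(@integral_itv_bndoo _ _ _ f true false); last exact: mfS.
    exact: (muf _ _ pq).1.
  pose F (n : nat) := `[p + n.+1%:R^-1, q - n.+1%:R^-1]%classic : set RR.
  have FE : \bigcup_n F n = `]p, q[%classic.
    apply/seteqP; split => x /=.
      move=> [n _]; rewrite /F/= !in_itv/= => /andP[px xq].
      have n0 : 0 < n.+1%:R^-1 :> R by rewrite invr_gt0.
      by move: n0 px xq; set r := _^-1 => *; apply/andP; split; lra.
    rewrite in_itv/= => /andP[px xq].
    have [n ne] : exists n, n.+1%:R^-1 < Num.min (x - p) (q - x).
      have : 0 < Num.min (x - p) (q - x) by rewrite lt_min !subr_gt0 px.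
      by move=> h; exact: (filter_ex (near_infty_natSinv_lt (PosNum h))).
    move: ne; rewrite lt_min => /andP[nx xn].
    exists n => //; rewrite /F/= in_itv/=.
    by move: nx xn; set r := _^-1 => *; apply/andP; split; lra.
  have ndF : nondecreasing_seq F.
    move=> i j ij; rewrite subsetEset => x; rewrite /F/= !in_itv/= => /andP[px xq].
    have : j.+1%:R^-1 <= i.+1%:R^-1 :> R by rewrite lef_pV2 ?posrE// ler_nat.
    move: px xq; set r := i.+1%:R^-1; set r' := j.+1%:R^-1 => *.
    by apply/andP; split; lra.
  have mF i : measurable (F i) by exact: measurable_itv.
  have cvgF := @ge0_nondecreasing_set_cvg_integral _ _ _ F f leb ndF mF
    (fun i => mfS _) (fun i x _ => f0 x).
  rewrite -FE; rewrite -(cvg_lim _ cvgF)//.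
  apply: lime_le; first by apply/cvg_ex; eexists; exact: cvgF.
  apply: nearW => n; have [pq'|pq'] := ltP (p + n.+1%:R^-1) (q - n.+1%:R^-1).
    apply: (le_trans (muf _ _ pq').2); apply: le_measure; rewrite ?inE//.
      exact: bigcup_measurable.
    by move=> x Fx; exists n.
  (* For small n the bounds may meet or cross; [F n] then has at most one point and the integral is
     0. *)
  rewrite (@integral_Sset1 _ _ _ (p + n.+1%:R^-1))//.
  move=> x; rewrite /F/= in_itv/= => /andP[px xq].
  by apply/eqP; rewrite eq_le px (le_trans xq).
move=> B mB; change (mu B = with_density leb mf f0 B).
(* Open intervals are stable under intersection and generate the Borel sets, and the intervals ]-n,
   n[ exhaust the line with finite mass. *)
apply: (@measure_unique _ R RR (@RGenOpens.G R) (fun n : nat => `](- n%:R), n%:R[%classic)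
  _ _ _ _ mu (with_density leb mf f0)) => //.
- exact: RGenOpens.measurableE.
- move=> A A' [x [y ->]] [x' [y' ->]]; exists (Num.max x x'), (Num.min y y').
  apply/seteqP; split => t /=; rewrite !in_itv/= gt_max lt_min.
    by move=> [/andP[-> ->] /andP[-> ->]].
  by move=> /andP[/andP[-> ->] /andP[-> ->]].
- by move=> n; exists (- n%:R), n%:R.
- apply/seteqP; split => // x _.
  exists (Num.truncn `|x|).+1 => //=; rewrite in_itv/= -ltr_norml.
  by rewrite Num.Theory.truncnS_gt.
- by move=> A [x [y ->]]; rewrite /with_density/= muE.
- by move=> n; rewrite (le_lt_trans (probability_le1 _ _))// ltry.
Qed.

End density_line.

(** * Measurability, positivity and zeros of the density *)

Section limit_density_properties.
Context {R : realType}.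
Local Notation RR := (measurableTypeR R).
Local Notation leb := (@lebesgue_measure R).
Variables (nu : probability RR R) (M b c : R).
Hypotheses (nuM : {ae nu, forall y, `|y| <= M}) (b01 : 0 < b < 1).
Hypothesis c0 : 0 < c.
Hypothesis cE : forall x : R, (c%:E <= \int[nu]_y (`|x - y| `^ b)%:E)%E.

Let b0 : 0 < b. Proof. by case/andP: b01. Qed.
Let bneq0 : b != 0. Proof. by rewrite gt_eqF. Qed.
Let b1neq0 : b - 1 != 0.
Proof. by case/andP: b01 => _ ?; rewrite lt_eqF// subr_lt0. Qed.

Let limit_densityE x := limit_densityE nuM b01 c0 cE x.

Lemma sin_bpi_gt0 : 0 < sin (b * pi).
Proof.
have /andP[_ b1] := b01; have p0 := @pi_gt0 R.
by apply: sin_gt0_pi; rewrite mulr_gt0// gtr_pMl.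
Qed.

Lemma int_pos_ge0 p (x : R) : (0 <= int_pos nu p x)%E.
Proof. by apply: integral_ge0 => y _; rewrite lee_fin powR_ge0. Qed.

Lemma int_neg_ge0 p (x : R) : (0 <= int_neg nu p x)%E.
Proof. by apply: integral_ge0 => y _; rewrite lee_fin powR_ge0. Qed.

Lemma measurable_int_pos p : measurable_fun setT (int_pos nu p : RR -> \bar R).
Proof.
apply: (@measurable_fun_fubini_tonelli_F _ _ RR RR R nu
  (fun xy => (tpos (xy.1 - xy.2) `^ p)%:E)).
  apply/measurable_EFinP; apply: (measurableT_comp (measurable_tpos_powR p)).
  by apply: measurable_funB; [exact: measurable_fst|exact: measurable_snd].
by move=> ?; rewrite lee_fin powR_ge0.
Qed.

Lemma measurable_int_neg p : measurable_fun setT (int_neg nu p : RR -> \bar R).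
Proof.
apply: (@measurable_fun_fubini_tonelli_F _ _ RR RR R nu
  (fun xy => (tneg (xy.1 - xy.2) `^ p)%:E)).
  apply/measurable_EFinP; apply: (measurableT_comp (measurable_tneg_powR p)).
  by apply: measurable_funB; [exact: measurable_fst|exact: measurable_snd].
by move=> ?; rewrite lee_fin powR_ge0.
Qed.

Lemma measurable_limit_density :
  measurable_fun setT (limit_density nu (2 * b) : RR -> \bar R).
Proof.
have -> : (limit_density nu (2 * b) : RR -> \bar R) = fun x =>
    ((sin (b * pi) / pi)%:E *
     ((int_pos nu b x * int_neg nu (b - 1) x +
       int_neg nu b x * int_pos nu (b - 1) x) *
      (density_den nu b x)^-1%:E))%E.
  by apply/funext => x; exact: limit_densityE.
have mA := measurable_int_pos b; have mB := measurable_int_neg b.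
have mfA : measurable_fun setT (fun x : RR => fine (int_pos nu b x)).
  exact: (measurableT_comp (fine_measurable measurableT) mA).
have mfB : measurable_fun setT (fun x : RR => fine (int_neg nu b x)).
  exact: (measurableT_comp (fine_measurable measurableT) mB).
apply: emeasurable_funM; first exact: measurable_cst.
apply: emeasurable_funM.
  apply: emeasurable_funD.
    by apply: emeasurable_funM; [exact: mA|exact: measurable_int_neg].
  by apply: emeasurable_funM; [exact: mB|exact: measurable_int_pos].
apply/measurable_EFinP.
(* As the denominator is positive, its inverse is its power -1, and powers are measurable. *)
rewrite (_ : (fun x => _) = (fun x => density_den nu b x `^ (-1))); last first.
  by apply/funext => x; rewrite powR_inv1// ltW//;
    exact: (density_den_gt0 nuM b01 c0 cE).
apply: (@measurableT_comp _ _ _ _ _ _ (@powR R ^~ (-1))); first exact: measurable_powR.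
rewrite /density_den; move: mfA mfB; set A := fun x => fine (int_pos nu b x).
set B := fun x => fine (int_neg nu b x); move=> mfA mfB.
apply: measurable_funD.
  by apply: measurable_funD; apply: measurable_funX; [exact: mfA|exact: mfB].
apply: measurable_funM; last exact: mfB.
by apply: measurable_funM; [exact: measurable_cst|exact: mfA].
Qed.

Lemma limit_density_ge0 x : (0 <= limit_density nu (2 * b) x)%E.
Proof.
rewrite limit_densityE; apply: mule_ge0.
  by rewrite lee_fin divr_ge0 ?pi_ge0// ltW// sin_bpi_gt0.
apply: mule_ge0; last by rewrite lee_fin invr_ge0 ltW//;
  exact: (density_den_gt0 nuM b01 c0 cE).
by apply: adde_ge0; apply: mule_ge0; rewrite ?int_pos_ge0 ?int_neg_ge0.
Qed.

(** If the integral were 0, the integrand would vanish almost everywhere, yet it is positive on a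
    ball that [nu] charges. The sign of p is arbitrary, since every power of a positive number is
    positive. *)
Lemma integral_powR_gt0 p (h : R -> R) y e : supp nu y -> 0 < e ->
  measurable_fun setT h -> (forall z, 0 <= h z) ->
  (forall z, ball y e z -> 0 < h z) ->
  (0 < \int[nu]_z (h z `^ p)%:E)%E.
Proof.
move=> ysupp e0 mh h0 hball.
rewrite lt0e integral_ge0 ?andbT; last by move=> z _; rewrite lee_fin powR_ge0.
apply/eqP => int0.
have mhp : measurable_fun setT (fun z : RR => (h z `^ p)%:E).
  apply/measurable_EFinP.
  apply: (@measurableT_comp _ _ _ _ _ _ (@powR R ^~ p)); [exact: measurable_powR|exact: mh].
have : ae_eq nu setT (fun z : RR => (h z `^ p)%:E) (cst 0%E).
  apply/(ae_eq_integral_abs nu measurableT mhp).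
  rewrite -[RHS]int0; apply: eq_integral => z _.
  by rewrite gee0_abs// lee_fin powR_ge0.
move=> ae0; apply: (supp_ball0 e0) ysupp; apply: ae_impl ae0 => z /(_ I)[hz0] yz.
by have := powR_gt0 p (hball z yz); rewrite hz0 ltxx.
Qed.

Lemma int_pos_gt0 p (x : R) : inf (supp nu) < x -> (0 < int_pos nu p x)%E.
Proof.
move=> /(inf_lt (supp_neq0 nu))[y ysupp yx].
apply: (@integral_powR_gt0 p (fun z => tpos (x - z)) y (x - y)) => //.
- by rewrite subr_gt0.
- apply: measurable_maxr; last exact: measurable_cst.
  by apply: measurable_funB; [exact: measurable_cst|exact: measurable_id].
- by move=> z; rewrite /tpos le_max lexx orbT.
- move=> z; rewrite /ball/= ltr_norml /tpos lt_max ltxx orbF => /andP[h1 h2]; lra.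
Qed.

Lemma int_neg_gt0 p (x : R) : x < sup (supp nu) -> (0 < int_neg nu p x)%E.
Proof.
move=> /(sup_gt (supp_neq0 nu))[y ysupp yx].
apply: (@integral_powR_gt0 p (fun z => tneg (x - z)) y (y - x)) => //.
- by rewrite subr_gt0.
- apply: measurable_maxr; last exact: measurable_cst.
  apply: measurableT_comp; first exact: oppr_measurable.
  by apply: measurable_funB; [exact: measurable_cst|exact: measurable_id].
- by move=> z; rewrite /tneg le_max lexx orbT.
- move=> z; rewrite /ball/= ltr_norml /tneg lt_max ltxx orbF => /andP[h1 h2]; lra.
Qed.

Lemma int_pos_eq0 p (x : R) : p != 0 -> x <= inf (supp nu) -> int_pos nu p x = 0%E.
Proof.
move=> p0 xinf; rewrite /int_pos -(integral0 nu setT).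
apply: ge0_ae_eq_integral => //.
- by apply/measurable_EFinP; exact: measurable_subl (measurable_tpos_powR p).
- by move=> y _; rewrite lee_fin powR_ge0.
- apply: ae_impl (ae_supp_itv nuM) => y /andP[infy _] _ /=.
  by rewrite /tpos max_r ?powR0// subr_le0 (le_trans xinf).
Qed.

Lemma int_neg_eq0 p (x : R) : p != 0 -> sup (supp nu) <= x -> int_neg nu p x = 0%E.
Proof.
move=> p0 xsup; rewrite /int_neg -(integral0 nu setT).
apply: ge0_ae_eq_integral => //.
- by apply/measurable_EFinP; exact: measurable_subl (measurable_tneg_powR p).
- by move=> y _; rewrite lee_fin powR_ge0.
- apply: ae_impl (ae_supp_itv nuM) => y /andP[_ ysup] _ /=.
  by rewrite /tneg max_r ?powR0// opprB subr_le0 (le_trans ysup).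
Qed.

Lemma limit_density_gt0 x : inf (supp nu) < x < sup (supp nu) ->
  (0 < limit_density nu (2 * b) x)%E.
Proof.
move=> /andP[xinf xsup]; rewrite limit_densityE; apply: mule_gt0.
  by rewrite lte_fin divr_gt0 ?pi_gt0// sin_bpi_gt0.
apply: mule_gt0; last by rewrite lte_fin invr_gt0;
  exact: (density_den_gt0 nuM b01 c0 cE).
by apply: adde_gt0; apply: mule_gt0; rewrite ?int_pos_gt0 ?int_neg_gt0.
Qed.

(** To the left of the support both integrals of positive parts vanish, to the right both of
    negative parts. Each product in the numerator contains one of them, and 0 * +oo = 0 settles the
    case of an infinite partner, possible at an endpoint. *)
Lemma limit_density_eq0 x : ~ (inf (supp nu) < x < sup (supp nu)) ->
  limit_density nu (2 * b) x = 0%E.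
Proof.
move=> /negP; rewrite negb_and -!leNgt limit_densityE => /orP[xinf|xsup].
  by rewrite !int_pos_eq0// mul0e mule0 adde0 mul0e mule0.
by rewrite !int_neg_eq0// mul0e mule0 adde0 mul0e mule0.
Qed.

End limit_density_properties.

(** * Stieltjes inversion for [mu] *)

Section inversion.
Context {R : realType}.
Local Notation RR := (measurableTypeR R).
Local Notation leb := (@lebesgue_measure R).
Variables (nu mu : probability RR R) (M b c : R).
Hypotheses (nuM : {ae nu, forall y, `|y| <= M}) (b01 : 0 < b < 1).
Hypothesis c0 : 0 < c.
Hypothesis cE : forall x : R, (c%:E <= \int[nu]_y (`|x - y| `^ b)%:E)%E.
Hypothesis mu_nu : forall x e, 0 < e ->
  \int[mu]_t poisson e (t - x) = im_ratio nu b e x.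

Let e (n : nat) : R := n.+1%:R^-1.
Let e_gt0 n : 0 < e n. Proof. by rewrite invr_gt0. Qed.

Lemma poisson_integralE n x : poisson_integral mu n x = (im_ratio nu b (e n) x)%:E.
Proof.
rewrite -mu_nu// /poisson_integral fineK//.
apply: (@integrable_fin_num _ _ _ mu setT measurableT).
apply: (@le_integrable _ _ _ mu setT measurableT _ (cst (e n)^-1%:E)).
- apply/measurable_EFinP.
  apply: (measurableT_comp (continuous_measurable_fun (continuous_poisson (e_gt0 n)))).
  by apply: measurable_funB; [exact: measurable_id|exact: measurable_cst].
- move=> t _; rewrite /cst !abse_EFin lee_fin ger0_norm ?poisson_ge0//.
  rewrite ger0_norm ?invr_ge0 ?(ltW (e_gt0 n))//.
  rewrite /poisson -/(e n); have := e_gt0 n; move: (e n) => r r0.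
  have h1 : 0 < (t - x) ^+ 2 + r ^+ 2 by rewrite ltr_wpDl ?sqr_ge0// exprn_gt0.
  by rewrite ler_pdivrMr// ler_pdivlMl// -expr2 lerDr sqr_ge0.
- exact: finite_measure_integrable_cst.
Qed.

Lemma integral_limit_density_between (p q : R) : p < q ->
  (mu `]p, q[%classic <= \int[leb]_(x in `[p, q]) limit_density nu (2 * b) x)%E /\
  (\int[leb]_(x in `[p, q]) limit_density nu (2 * b) x <= mu `[p, q]%classic)%E.
Proof.
move=> pq; have [l [cvgl mul lmu]] := cvg_integral_poisson_integral mu pq.
have p0 := @pi_gt0 R.
pose f x := (pi%:E * limit_density nu (2 * b) x)%E.
have mf : measurable_fun setT f.
  apply: emeasurable_funM; first exact: measurable_cst.
  exact: (measurable_limit_density nuM b01 c0 cE).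
(* The constant of [im_ratio_le]; it is the same for all x because [c] is. *)
pose K := 2 / (cos (b * pi / 2) ^+ 2 * c).
have iK : leb.-integrable `[p, q] (fun x => K%:E * potential b nu x)%E.
  apply: integrableZl; first exact: measurable_itv.
  apply/integrableP; split; first exact: measurable_funTS (measurable_potential b nu).
  under eq_integral do rewrite gee0_abs ?potential_ge0//.
  exact: (integral_potential_lty b01 nuM pq).
have aex : {ae leb, forall x, x \in `[p, q] -> {ae nu, forall y, x - y != 0} /\
    nu.-integrable setT (fun y => (`|x - y| `^ (b - 1))%:E)}.
  have h1 := ae_potential_lty b01 nuM pq; have h2 := ae_not_atom nu.
  have : {ae leb, forall x, (x \in `[p, q] -> (potential b nu x < +oo)%E) /\
     {ae nu, forall y, x - y != 0}}.
    have := negligibleU h1 h2; apply: negligibleS.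
    by move=> x /= /not_andP[h|h]; [left|right].
  apply: ae_impl => x [xpot xat] xpq; split => //; apply/integrableP; split.
    by apply/measurable_EFinP; exact: measurable_subl (measurable_norm_powR _).
  by under eq_integral do rewrite gee0_abs ?lee_fin ?powR_ge0//; exact: xpot.
have [||_ _ cvgI] := @dominated_convergence _ _ _ leb `[p, q]%classic (measurable_itv _)
  (fun n => poisson_integral mu n) f (fun x => K%:E * potential b nu x)%E
  (fun n => measurable_funTS (measurable_poisson_integral mu n))
  (measurable_funTS mf) _ iK _.
- apply: ae_impl aex => x h xpq; have [xat xint] := h xpq.
  under eq_fun do rewrite poisson_integralE.
  apply: (cvg_im_ratio nuM b01 c0 cE) => //; first exact: cvg_harmonic.
  by move=> n; rewrite invf_le1// ler1n.
- apply: ae_impl aex => x h n xpq; have [xat xint] := h xpq.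
  rewrite poisson_integralE abse_EFin.
  have pfin : potential b nu x \is a fin_num by exact: integrable_fin_num xint.
  rewrite -(fineK pfin) -EFinM lee_fin.
  exact: (im_ratio_le nuM b01 xat xint c0 (cE x)).
have lE : l = (pi%:E * \int[leb]_(x in `[p, q]) limit_density nu (2 * b) x)%E.
  rewrite -ge0_integralZl//.
  - exact: (cvg_unique _ cvgl cvgI).
  - apply: measurable_funTS; exact: (measurable_limit_density nuM b01 c0 cE).
  - move=> x _; exact: (limit_density_ge0 nuM b01 c0 cE).
  - by rewrite lee_fin ltW.
by move: mul lmu; rewrite lE !lee_pmul2l// => *; split.
Qed.

Lemma measure_limit_density B : measurable B ->
  mu B = (\int[leb]_(x in B) limit_density nu (2 * b) x)%E.
Proof.
apply: eq_measure_density.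
- exact: (measurable_limit_density nuM b01 c0 cE).
- exact: (limit_density_ge0 nuM b01 c0 cE).
- exact: integral_limit_density_between.
Qed.

End inversion.

(** * The Stieltjes identity in real coordinates *)

Section stieltjes_identity.
Context {R : realType}.
Local Notation RR := (measurableTypeR R).

Lemma cintegral_cpow (nu : {measure set RR -> \bar R}) p (x e : R) : 0 < e ->
  cintegral nu (fun y => cpow ((x +i* e) - y%:C) p) =
  (\int[nu]_y re_pow p e (x - y)) +i* (\int[nu]_y im_pow p e (x - y)).
Proof.
move=> e0; rewrite /cintegral; congr (_ +i* _); apply: eq_Rintegral => y _;
  rewrite (_ : (x +i* e) - y%:C = (x - y) +i* e) ?cpowE ?ltW//;
  by apply/eqP; rewrite eq_complex/= subr0 !eqxx.
Qed.

Lemma Im_opp_div (a b c d : R) :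
  complex.Im (- ((a +i* b) / (c +i* d))) = (a * d - b * c) / (c ^+ 2 + d ^+ 2).
Proof. by rewrite /=; ring. Qed.

End stieltjes_identity.

Theorem theorem3p7 (R : realType) (alpha : R) (halpha : 0 < alpha < 2)
  (d0 : measure_display) (T0 : measurableType d0) (P0 : probability T0 R)
  (xi : {RV P0 >-> R})
  (xi_sym : symmetric_rv xi) (xi_rv : regularly_varying alpha xi)
  (d : measure_display) (T : measurableType d) (P : probability T R)
  (X : nat -> {RV P >-> R}) (X_iid : iid_copies xi X)
  (A : forall n : nat, T -> 'M[R[i]]_n)
  (A_meas : forall n k, measurable_fun setT (mx_coord (A n) k))
  (A_herm : forall n w, A n w \is hermsymmx)
  (A_indep : forall n,
    independent_families P (mx_coord (A n)) (@self_normalized R T X n))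
  (A_bounded : {ae P, forall w, (limn_esup (fun n =>
    (\big[Num.max/0]_(i < n) `|mx_diag (A n) w i|)%:E) < +oo)%E})
  (nu : probability (measurableTypeR R) R)
  (A_cvg : {ae P, forall w,
    weak_cvg (fun n => empirical_measure (mx_diag (A n) w)) nu})
  (mu : probability (measurableTypeR R) R)
  (mu_limit : weak_cvg (fun n => pushforward P (fun w =>
    (\sum_(i < n) mx_diag (A n) w i * self_normalized X i w ^+ 2)
      : measurableTypeR R)) mu)
  (mu_stieltjes : forall z : R[i],
    ~ [set x%:C | x in `[inf (supp nu), sup (supp nu)]] z ->
    stieltjes mu z =
    - (cintegral nu (fun x => cpow (z - x%:C) (alpha / 2 - 1)) /
       cintegral nu (fun x => cpow (z - x%:C) (alpha / 2))))
  (nu_nondegenerate : ~ degenerate nu) :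
  let f := limit_density nu alpha in
  let K := [set x : R | inf (supp nu) < x < sup (supp nu)] in
  [/\ forall x : R, mu [set x] = 0%E,
      mu `<< lebesgue_measure,
      measurable_fun [set: R] f /\
        (forall B, measurable B ->
          mu B = (\int[lebesgue_measure]_(x in B) f x)%E),
      {ae lebesgue_measure, forall x, f x \is a fin_num} &
      (forall x, K x -> (0 < f x)%E) /\ (forall x, ~ K x -> f x = 0%E)].

Proof.
have /andP[alpha0 alpha2] := halpha; pose b := alpha / 2.
have alphaE : alpha = 2 * b by rewrite /b; field.
have b01 : 0 < b < 1 by rewrite /b; apply/andP; split; lra.
have b0 : 0 < b by case/andP: b01.
(* As [nu] is deterministic, one outcome suffices to bound its support. *)
have [w [Abd Acvg]] := ae_exists (filterI A_bounded A_cvg).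
have [M nuM] := weak_cvg_bounded Acvg Abd.
have [c c0 cE] := integral_dist_powR_gt0 b0 nu_nondegenerate.
have mu_nu x e : 0 < e -> \int[mu]_t poisson e (t - x) = im_ratio nu b e x.
  (* The point x + i e is off the real axis, hence outside the excluded segment. *)
  move=> e0; rewrite -Im_stieltjes// mu_stieltjes; last first.
    by move=> [y _ /(congr1 (@complex.Im R))/= ez]; move: e0; rewrite -ez ltxx.
  by rewrite !cintegral_cpow// Im_opp_div.
have muE := measure_limit_density nuM b01 c0 cE mu_nu.
have mf := measurable_limit_density nuM b01 c0 cE.
have f0 := limit_density_ge0 nuM b01 c0 cE.
rewrite alphaE; split.
- by move=> x; rewrite muE// integral_set1.
- apply/null_content_dominatesP => B mB B0; rewrite muE//.
  apply: null_set_integral => //; exact: measurable_funTS.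
- by split.
(* The density is non-negative with total integral [mu setT] = 1, so it is integrable and therefore
   finite almost everywhere. *)
- have i_f : lebesgue_measure.-integrable setT (limit_density nu (2 * b)).
    apply/integrableP; split => //.
    under eq_integral do rewrite gee0_abs//.
    by rewrite -muE// probability_setT ltry.
  by apply: ae_impl (integrable_ae measurableT i_f) => x; exact.
- split=> x; first exact: (limit_density_gt0 nuM b01 c0 cE).
  exact: (limit_density_eq0 nuM b01 c0 cE).
Qed.
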